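(* Let $\chi$ be a quadratic, odd, primitive Dirichlet character modulo $q$, where $q\ge 2\cdot 10^{23}$. Then $L(1,\chi)\le \frac{1}{2}\log q$.
   Context: $L(s,\chi)=\sum_{n\ge1}\chi(n)n^{-s}$ is the Dirichlet $L$-function of $\chi$. A character is odd if $\chi(-1)=-1$ and quadratic if it takes only real values (and is non-principal). *)

(* Defs.v *)
From HB Require Import structures.
From mathcomp Require Import all_boot all_order all_algebra.
From mathcomp Require Import all_classical all_reals all_analysis.
From mathcomp Require Import complex.

Set Implicit Arguments.
Unset Strict Implicit.
Unset Printing Implicit Defensive.

Import Order.TTheory GRing.Theory Num.Theory.
Import numFieldNormedType.Exports.

Local Open Scope ring_scope.
Local Open Scope complex_scope.

Section DirichletCharacter.
Variable R : realType.
Implicit Types (q : nat) (chi : int -> R[i]) (s : R[i]).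

Definition dirichlet_character q chi : Prop :=
  [/\ forall n, chi (n + q%:Z) = chi n,
      forall m n, chi (m * n) = chi m * chi n
    & forall n, (chi n != 0) = coprimez n q%:Z].

Definition principal q chi : Prop :=
  forall n, coprimez n q%:Z -> chi n = 1.

Definition primitive q chi : Prop :=
  forall (d : nat) (psi : int -> R[i]),
    (d %| q)%N -> (d < q)%N -> dirichlet_character d psi ->
    ~ (forall n, coprimez n q%:Z -> chi n = psi n).

Definition odd_character chi : Prop := chi (-1) = -1.

Definition quadratic q chi : Prop :=
  (forall n, chi n \is Num.real) /\ ~ principal q chi.

(* n ^ (- s) = exp (- s log n), for n >= 1 *)
Definition natpowN (n : nat) s : R[i] :=
  let t := complex.Im s * ln n%:R in
  (expR (- (complex.Re s * ln n%:R)))%:C * (cos t -i* sin t).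

(* The sum of the Dirichlet series, as the limit of its partial sums; it is
   meaningful wherever the series converges, in particular at s = 1 when chi
   is non-principal. R[i]^o is R[i] with the topology of its norm. *)
Definition dirichlet_L chi s : R[i] :=
  limn (series (fun k : nat => (chi k.+1%:Z * natpowN k.+1 s) : R[i]^o)).

End DirichletCharacter.

(* Main.v *)
Require Import Defs.
From HB Require Import structures.
From mathcomp Require Import all_boot all_order all_algebra.
From mathcomp Require Import all_classical all_reals all_analysis.
From mathcomp Require Import complex.
From mathcomp Require cyclic.
From mathcomp Require Import ring lra zify.
From Stdlib Require Zify.

Import Order.TTheory GRing.Theory Num.Theory.
Import numFieldNormedType.Exports.

Local Open Scope ring_scope.
Local Open Scope complex_scope.

Set Implicit Arguments.
Unset Strict Implicit.
Unset Printing Implicit Defensive.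

(** Write x n = chi n (real, in {-1,0,1}), r = ceil (sqrt q), and call a prime
    p bad if x p <> 1.

    Expanding chi in its Gauss sum (only sines occur, chi being odd) and using
    Parseval, |sum_{a,b < k} x (a+b+1)| <= sqrt q * k for every k.  The double
    sum is the sum of x against a triangular hat of centre and radius k, and
    hats with weights 1/((k-1)k(k+1)), k >= r, add up to 1/n + O(1/n^3) for
    n >= 2r.
    Hence L(1,chi) <= sum_n x n * w n + 1 + o(1), where w n <= 1/n is supported
    on n < 2r; since sum_n w n is about log r + 0.47, it suffices to show that
    the saving D = sum_n w n * (1 - x n) is at least 1.54.

    By the hat inequality at k = 16 r, x has small mean there, so the
    subadditivity 1 - x n <= sum_{p | n} (1 - x p) gives
    sum_{p < 32 r} (1 - x p)/p >= 15/16.  Primes close to r carry little of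
    this mass by Mertens' bound sum_{A < p <= B} log p / p <= log (B/A) + 1.4,
    while a bad prime p contributes (1 - x p)/p * log (r/p) to D, through the
    integers p * m whose cofactor m has no small bad prime. *)

(** The difficulty is overlap. A product of two bad primes may have x n = 1, and an n with several
    bad divisors must not be counted several times. Cofactors are therefore sieved by a set B of bad
    primes, which costs the factor 1 minus the sum of 1/p over B; cofactors with x m <> 1 cost at
    most a multiple of D itself, so that loss is moved to the other side as D * (1 + s/2), s being
    the sum of (1 - x p)/p over B. The sieve is useful only if B is light, hence a dichotomy on the
    mass of the bad primes up to sqrt (2r), with threshold 0.245. If they carry more, they alone are
    used, and only up to the first one where the mass reaches 0.245. If they carry less, B consists
    of all of them and every bad prime contributes: two bad primes beyond sqrt (2r) have a product
    outside the support of w, so they never overlap. The size of q enters through log r >= 26.6: it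
    makes the gain of a prime p <= sqrt (2r) at least 13.07 / p, and it keeps the mass of the primes
    near r, which is of order 1 / log r, small. *)

(** * Triangular hats *)

(* max(0, r - |n - r|) *)
Definition hat (r n : nat) : nat := minn n (r.*2 - n).

(** [hat r n] counts the pairs a, b < r with a + b + 1 = n. Enlarging the square adds a column,
    where n runs over (r, 2r], and a row, where n runs over (r, 2r + 1]. *)
Lemma hatS (r n : nat) :
  hat r.+1 n = (hat r n + (r < n <= r.*2)%N + (r < n <= r.*2.+1)%N)%N.
Proof. by rewrite /hat; case: (leqP n r.*2.+1); case: (leqP n r.*2); case: (ltnP r n) => /=; lia. Qed.

Lemma sum_hat (R : comPzRingType) (f : nat -> R) (r : nat) :
  \sum_(a < r) \sum_(b < r) f (a + b).+1 =
  \sum_(0 <= n < r.*2) f n * (hat r n)%:R.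
Proof.
elim: r => [|r IH]; first by rewrite big_ord0 big_geq.
have -> : \sum_(0 <= n < (r.+1).*2) f n * (hat r.+1 n)%:R =
  \sum_(0 <= n < r.*2) f n * (hat r n)%:R
  + \sum_(r.+1 <= n < r.*2.+1) f n + \sum_(r.+1 <= n < r.*2.+2) f n.
  under eq_bigr do rewrite hatS !natrD !mulrDr.
  rewrite !big_split /= doubleS; congr (_ + _ + _).
  - rewrite 2?big_nat_recr //= [hat r r.*2](_ : _ = 0%N); last by rewrite /hat; lia.
    rewrite [hat r r.*2.+1](_ : _ = 0%N); last by rewrite /hat; lia.
    by rewrite !mulr0 !addr0.
  - rewrite (@big_cat_nat _ _ _ r.+1) //=; last by lia.
    rewrite big_nat big1 ?add0r; last first.
      by move=> i ?; rewrite (_ : (_ < _ <= _)%N = false) ?mulr0 //; lia.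
    rewrite (@big_cat_nat _ _ _ r.*2.+1) /=; [|lia|lia].
    rewrite [X in _ + X]big_nat [X in _ + X]big1 ?addr0; last first.
      by move=> i ?; rewrite (_ : (_ < _ <= _)%N = false) ?mulr0 //; lia.
    by apply: eq_big_nat => i ?; rewrite (_ : (_ < _ <= _)%N) ?mulr1 //; lia.
  - rewrite (@big_cat_nat _ _ _ r.+1) //=; last by lia.
    rewrite big_nat big1 ?add0r; last first.
      by move=> i ?; rewrite (_ : (_ < _ <= _)%N = false) ?mulr0 //; lia.
    by apply: eq_big_nat => i ?; rewrite (_ : (_ < _ <= _)%N) ?mulr1 //; lia.
rewrite -IH.
under eq_bigr do rewrite big_ord_recr /=.
rewrite big_split /= big_ord_recr /= -!addrA; congr (_ + _).
congr (_ + _).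
  rewrite -(add0n r.+1) -addnn -addnS big_addn addnK big_mkord.
  by apply: eq_bigr => i _; congr f; lia.
rewrite (_ : r.*2.+2 = r.+1 + r.+1)%N; last by lia.
rewrite -[X in _ = \sum_(X <= _ < _) _]add0n big_addn addnK big_mkord.
by apply: eq_bigr => i _; congr f; lia.
Qed.

Lemma sum_hat1 (r : nat) : (\sum_(0 <= n < r.*2) hat r n = r ^ 2)%N.
Proof.
have := @sum_hat int (fun=> 1) r; rewrite /=.
under eq_bigr do rewrite sumr_const card_ord.
rewrite sumr_const card_ord -mulrnA.
under [RHS]eq_bigr do rewrite mul1r.
rewrite -natr_sum => /eqP; rewrite eqr_nat => /eqP <-; lia.
Qed.

Lemma sum_dvdn (p N : nat) : (0 < p)%N ->
  (\sum_(0 <= n < N.+1) (p %| n) = (N %/ p).+1)%N.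
Proof.
move=> p0; elim: N => [|N IH]; first by rewrite big_nat1 dvdn0 div0n.
by rewrite big_nat_recr //= IH divnS // addSn addnC.
Qed.

(** The terms form the arithmetic progression N, N - p, ..., N mod p, of length N / p + 1; when p
    divides N its last term is 0, which is why the range may stop before N. *)
Lemma sum_dvdn_sub (p N : nat) : (0 < p)%N ->
  (2 * \sum_(0 <= n < N) (p %| n) * (N - n) = (N %/ p).+1 * (N + N %% p))%N.
Proof.
move=> p0; elim: N => [|N IH]; first by rewrite big_geq // div0n mod0n.
have -> : (\sum_(0 <= n < N.+1) (p %| n) * (N.+1 - n) =
           \sum_(0 <= n < N) (p %| n) * (N - n) + \sum_(0 <= n < N.+1) (p %| n))%N.
  rewrite !big_nat_recr //= subSnn muln1 addnA -big_split /=; congr (_ + _)%N.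
  by apply: eq_big_nat => i /andP[_ iN]; rewrite subSn ?mulnS ?(ltnW iN) // addnC.
rewrite mulnDr IH sum_dvdn // modnS divnS //.
have := divn_eq N p; have := ltn_pmod N p0.
case: (boolP (p %| N.+1)%N) => [/dvdnP[k hk]|hnd] hs hN; last by lia.
rewrite hk in hN *.
have e : (p = (N %% p).+1)%N.
  have : (N.+1 %% p = 0)%N by rewrite hk modnMl.
  move: hs; rewrite -[in (N.+1 %% p)%N]addn1 -modnDml leq_eqVlt => /orP[/eqP //|h].
  by rewrite modn_small ?addn1.
nia.
Qed.

(** The hat is the ramp from 2r minus twice the ramp from r, so both sums have closed forms. The
    difference of the two sides is the square of the distance from r to the nearest multiple of p.
    The absence of an error term lets [bad_mass] sum over all primes below 2r without loss. *)
Lemma sum_hat_dvdn (p r : nat) : (0 < p)%N ->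
  (p * \sum_(0 <= n < r.*2) (p %| n) * hat r n <= r ^ 2)%N.
Proof.
move=> p0.
have E : (\sum_(0 <= n < r.*2) (p %| n) * hat r n + 2 * \sum_(0 <= n < r) (p %| n) * (r - n)
   = \sum_(0 <= n < r.*2) (p %| n) * (r.*2 - n))%N.
  have -> : (\sum_(0 <= n < r) (p %| n) * (r - n) = \sum_(0 <= n < r.*2) (p %| n) * (r - n))%N.
    rewrite [RHS](@big_cat_nat _ _ _ r) //=; last by lia.
    rewrite [X in (_ + X)%N]big_nat [X in (_ + X)%N]big1 ?addn0 // => i ?.
    by rewrite (_ : r - i = 0)%N ?muln0 //; lia.
  rewrite big_distrr -big_split /=; apply: eq_bigr => n _.
  by rewrite /hat; case: (p %| n)%N; lia.
have := sum_dvdn_sub r p0; have := sum_dvdn_sub r.*2 p0.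
rewrite -E; move: (\sum_(0 <= n < r.*2) (p %| n) * hat r n)%N => S.
move: (\sum_(0 <= n < r) (p %| n) * (r - n))%N => Q {E}.
have hr := divn_eq r p; have hs := ltn_pmod r p0.
move: (r %/ p)%N (r %% p)%N hr hs => k s hr hs.
have -> : (r.*2 = (k.*2 * p + s.*2))%N by rewrite hr; lia.
rewrite divnMDl // modnMDl {}hr.
case: (leqP p s.*2) => hsp.
  have -> : (s.*2 %/ p = 1)%N by rewrite -[s.*2](subnK hsp) divnDr // divnn p0 divn_small //; lia.
  have -> : (s.*2 %% p = s.*2 - p)%N by rewrite -[in LHS](subnK hsp) modnDr modn_small //; lia.
  have [j hj] : exists j, (p = s + j)%N by exists (p - s)%N; lia.
  have [i hi] : exists i, (s = j + i)%N by exists (s - j)%N; lia.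
  subst p; subst s; rewrite (_ : (j + i).*2 - (j + i + j) = i)%N; last by lia.
  move=> h1 h2.
  have -> : (S = k ^ 2 * (j + i + j) + 2 * k * (j + i) + i)%N by nia.
  nia.
rewrite divn_small // modn_small // => h1 h2.
have -> : (S = k ^ 2 * p + 2 * k * s)%N by nia.
nia.
Qed.

(** * Prime sums *)

Lemma prod_primes_dvdn (s : seq nat) (N : nat) : uniq s -> all prime s ->
  all (fun p => p %| N)%N s -> (\prod_(p <- s) p %| N)%N.
Proof.
elim: s => [|p s IH] /=; first by rewrite big_nil dvd1n.
move=> /andP[ps us] /andP[pp ap] /andP[pN aN]; rewrite big_cons Gauss_dvd ?pN ?IH //.
rewrite coprime_sym big_seq; elim/big_ind: _ => [|a b ca cb|i si]; first exact: coprime1n.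
  by rewrite coprimeMl ca.
rewrite coprime_sym prime_coprime // dvdn_prime2 ?(allP ap _ si) //.
by apply: contraNneq ps => ->.
Qed.

(** By symmetry the coefficient occurs twice in the expansion of (1 + 1) ^ (2m + 1). *)
Lemma binS_le (m : nat) : ('C(m.*2.+1, m.+1) <= 4 ^ m)%N.
Proof.
have : ('C(m.*2.+1, m) + 'C(m.*2.+1, m.+1) <= 2 ^ m.*2.+1)%N.
  rewrite -[X in (_ <= X ^ _)%N]/(1 + 1)%N expnDn.
  have hm : (m.+1 < (m.*2.+1).+1)%N by lia.
  rewrite (bigD1 (Ordinal hm)) //=.
  have hm' : (m < (m.*2.+1).+1)%N by lia.
  rewrite (bigD1 (Ordinal hm')) /=; last by apply/eqP => -[]; lia.
  rewrite !exp1n !muln1; lia.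
have -> : 'C(m.*2.+1, m) = 'C(m.*2.+1, m.+1).
  rewrite -[LHS]bin_sub; last by lia.
  by congr 'C(_, _); lia.
rewrite expnS -mul2n -[X in (2 * 2 ^ X)%N]mulnC (_ : 2 ^ (m * 2) = 4 ^ m)%N; first by lia.
by rewrite mulnC expnM.
Qed.

(** Erdos' induction: an even n > 2 adds no prime, and for n = 2m + 1 the primes in (m + 1, 2m + 1]
    all divide C(2m + 1, m + 1) <= 4 ^ m. *)
Lemma primorial_le (n : nat) : (\prod_(0 <= p < n.+1 | prime p) p <= 4 ^ n)%N.
Proof.
elim/ltn_ind: n => n IH.
case: (ltnP n 3) => [|n3].
  by case: n {IH} => [|[|[|n]]] // _; rewrite big_mkcond !big_nat_recr //= big_geq.
case: (boolP (odd n)) => on; last first.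
  case: n IH n3 on => // n IH n3 on.
  rewrite big_mkcond big_nat_recr //= -big_mkcond /= ifF ?muln1; last first.
    by apply: contraNF on => pn; case: (even_prime pn) => // h; lia.
  by apply: leq_trans (IH n _) _ => //; rewrite leq_exp2l.
have [m nm] : exists m, n = m.*2.+1 by exists n./2; rewrite -[LHS]odd_double_half on.
rewrite nm (@big_cat_nat _ _ _ m.+2) //=; last by lia.
have -> : (4 ^ m.*2.+1 = 4 ^ m.+1 * 4 ^ m)%N by rewrite -expnD; congr expn; lia.
apply: leq_mul; first by apply: IH; lia.
apply: leq_trans (binS_le m); apply: dvdn_leq; first by rewrite bin_gt0; lia.
rewrite -big_filter; apply: prod_primes_dvdn.
- by rewrite filter_uniq // iota_uniq.
- by rewrite filter_all.
apply/allP => p; rewrite mem_filter mem_index_iota => /and3P[pp p1 p2].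
have hm : (m.+1 <= m.*2.+1)%N by lia.
have hs : (m.*2.+1 - m.+1 = m)%N by lia.
have hb := bin_fact hm; rewrite hs in hb.
have : (p %| m.*2.+1`!)%N by rewrite dvdn_fact // (ltn_trans _ p1).
rewrite -hb Euclid_dvdM // Euclid_dvdM // => /orP[//|].
have nf k : (k < p)%N -> (p %| k`!)%N = false.
  elim: k => [|k IHk] kp; first by rewrite Euclid_dvd1.
  by rewrite factS Euclid_dvdM // IHk ?(ltnW kp) // orbF gtnNdvd.
by rewrite !nf //; lia.
Qed.

Section Mertens.
Variable R : realType.
Implicit Types (p n m A B s : nat).

Lemma ln_nat_ge0 n : 0 <= ln (n%:R : R).
Proof.
case: n => [|n]; first by rewrite ln0.
by rewrite ln_ge0 // ler1n.
Qed.

Lemma ln_prodn (r : seq nat) (P : pred nat) (F : nat -> nat) :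
  (forall i, P i -> (0 < F i)%N) ->
  ln ((\prod_(i <- r | P i) F i)%N%:R : R) = \sum_(i <- r | P i) ln (F i)%:R.
Proof.
move=> F0.
suff [] : (0 < \prod_(i <- r | P i) F i)%N /\
  ln ((\prod_(i <- r | P i) F i)%N%:R : R) = \sum_(i <- r | P i) ln (F i)%:R by [].
apply: (big_rec2 (fun (a : nat) (b : R) => (0 < a)%N /\ ln (a%:R : R) = b)).
  by rewrite ln1.
move=> i b a Pi [b0 <-]; split; first by rewrite muln_gt0 F0.
by rewrite natrM lnM // posrE ltr0n ?F0.
Qed.

Lemma theta_le n : \sum_(0 <= p < n.+1 | prime p) ln (p%:R : R) <= n%:R * ln 4.
Proof.
rewrite -(@ln_prodn _ _ id) => [|p /prime_gt0//].
have -> : n%:R * ln 4 = ln ((4 ^ n)%N%:R : R) by rewrite natrX lnXn // mulr_natl.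
rewrite ler_ln ?posrE ?ltr0n ?expn_gt0 // ?ler_nat; first exact: primorial_le.
by rewrite big_seq_cond; elim/big_ind: _ => // [a b|p /andP[_ /prime_gt0]] //; rewrite muln_gt0 => -> ->.
Qed.

(** The range is allowed to exceed m so that factorials of different sizes can be compared over a
    single set of p; [logn p m] is 0 when p is not prime. *)
Lemma ln_logn m N : (0 < m <= N)%N ->
  ln (m%:R : R) = \sum_(0 <= p < N.+1) (logn p m)%:R * ln p%:R.
Proof.
move=> /andP[m0 mN].
rewrite -{1}(partnT m0) /partn ln_prodn; last first.
  move=> p _; case: (posnP p) => [->|p0]; last by rewrite expn_gt0 p0.
  by rewrite /logn.
rewrite [RHS](@big_cat_nat _ _ _ m.+1) //= [X in _ = _ + X]big_nat_cond.
rewrite [X in _ = _ + X]big1 ?addr0.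
  apply: eq_bigr => p _; case: (posnP p) => [->|p0].
    by rewrite /logn /= mul0r expn0 ln1.
  by rewrite natrX lnXn ?ltr0n // mulr_natl.
move=> p /andP[/andP[mp _] _]; rewrite (_ : logn p m = 0%N) ?mul0r //.
apply/eqP; rewrite -leqn0 leqNgt logn_gt0 mem_primes negb_and m0 /=.
by rewrite gtnNdvd ?orbT.
Qed.

Lemma ln_fact_logn n N : (n <= N)%N ->
  ln (n`!%:R : R) = \sum_(0 <= p < N.+1) (logn p n`!)%:R * ln p%:R.
Proof.
elim: n => [|n IH] nN.
  by rewrite fact0 ln1 big1 // => p _; rewrite logn1 mul0r.
rewrite factS natrM lnM ?posrE ?ltr0n ?fact_gt0 // IH ?(ltnW nN) //.
rewrite (@ln_logn n.+1 N) // -big_split; apply: eq_bigr => p _ /=.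
by rewrite lognM ?fact_gt0 // natrD mulrDl.
Qed.

Lemma ln_fact_ge n : n%:R * ln n%:R - n%:R <= ln (n`!%:R : R).
Proof.
elim: n => [|n IH]; first by rewrite fact0 ln1 mul0r subr0.
rewrite factS natrM lnM ?posrE ?ltr0n ?fact_gt0 //.
case: n IH => [_|n IH]; first by rewrite fact0 !ln1 mulr0; lra.
have n0 : 0 < n.+1%:R :> R by rewrite ltr0n.
have h : ln (n.+2%:R : R) <= ln n.+1%:R + n.+1%:R^-1.
  have -> : n.+2%:R = n.+1%:R * (1 + n.+1%:R^-1) :> R by rewrite mulrDr mulr1 divff ?lt0r_neq0 // -natr1.
  rewrite lnM ?posrE // ?addr_gt0 ?invr_gt0 // lerD2l le_ln1Dx //.
  by rewrite (lt_trans _ (_ : 0 < _)) ?ltrN10 ?invr_gt0.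
have : n.+1%:R * ln n.+2%:R <= n.+1%:R * ln n.+1%:R + 1 :> R.
  by rewrite -(ler_pM2l n0) in h; rewrite mulrDr divff ?lt0r_neq0 in h.
rewrite -(natr1 n.+1); lra.
Qed.

Lemma ln_fact_le n : ln (n.+1`!%:R : R) <= n.+2%:R * ln n.+1%:R - n%:R.
Proof.
elim: n => [|n IH]; first by rewrite ln1 mulr0 subr0.
rewrite factS natrM lnM ?posrE ?ltr0n ?fact_gt0 //.
have n0 : 0 < n.+2%:R :> R by rewrite ltr0n.
have h : ln (n.+1%:R : R) <= ln n.+2%:R - n.+2%:R^-1.
  have -> : n.+1%:R = n.+2%:R * (1 + - n.+2%:R^-1) :> R.
    by rewrite mulrDr mulr1 mulrN divff ?lt0r_neq0 // -(natr1 n.+1) addrK.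
  have h1 : n.+2%:R^-1 < 1 :> R by rewrite invf_lt1 // ltr1n.
  by rewrite lnM ?posrE // ?subr_gt0 // lerD2l le_ln1Dx // ltrN2.
have : n.+2%:R * ln n.+1%:R <= n.+2%:R * ln n.+2%:R - 1 :> R.
  by rewrite -(ler_pM2l n0) in h; rewrite mulrBr divff ?lt0r_neq0 in h.
move: IH; move: (ln n.+2%:R) (ln n.+1%:R) (ln _`!%:R) => u v w.
by rewrite -(natr1 n.+2) -(natr1 n.+1) -(natr1 n) => *; lra.
Qed.

(** For prime p this is the integer part of log_p A, written over the range of Legendre's formula so
    that it merges with that sum in [logn_fact_compare]. *)
Definition npow p A : nat := \sum_(1 <= k < A.+1) (p ^ k <= A)%N.

Lemma npow_ln p A : prime p -> (npow p A)%:R * ln (p%:R : R) <= ln A%:R.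
Proof.
move=> pp; case: (posnP A) => [->|A0].
  by rewrite /npow big_geq // mul0r ln_nat_ge0.
have p1 := prime_gt1 pp.
have h : (npow p A <= trunc_log p A)%N.
  apply: (@leq_trans (\sum_(1 <= k < A.+1) (k <= trunc_log p A))%N).
    apply: leq_sum => k _; case: (leqP (p ^ k) A) => // hk.
    by rewrite trunc_log_max.
  have E N : (\sum_(1 <= k < N.+1) (k <= trunc_log p A) <= trunc_log p A)%N.
    have -> : (\sum_(1 <= k < N.+1) (k <= trunc_log p A) = minn N (trunc_log p A))%N.
      elim: N => [|N IH]; first by rewrite big_geq // min0n.
      by rewrite big_nat_recr //= IH; lia.
    exact: geq_minr.
  exact: E.
have p0 : 0 < p%:R :> R by rewrite ltr0n prime_gt0.
have -> : (npow p A)%:R * ln p%:R = ln ((p ^ npow p A)%N%:R : R).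
  by rewrite natrX lnXn // mulr_natl.
rewrite ler_ln ?posrE ?ltr0n ?expn_gt0 ?(prime_gt0 pp) // ler_nat.
by apply: leq_trans (trunc_logP p1 A0); rewrite leq_exp2l.
Qed.

Lemma npow_le1 p A : (A < p ^ 2)%N -> (npow p A <= 1)%N.
Proof.
move=> h; have p0 : (0 < p)%N by case: (posnP p) h => // ->.
rewrite /npow; case: A h => [|A] h; first by rewrite big_geq.
rewrite big_nat_recl // -[X in (_ <= X)%N]addn0; apply: leq_add; first exact: leq_b1.
rewrite big_nat big1 // => k /andP[k1 _].
apply/eqP; rewrite eqb0 -ltnNge; apply: leq_trans h _.
by rewrite leq_pexp2l.
Qed.

(** For each power P of p, B * floor (A/P) <= A * B / P < A * (floor (B/P) + 1). The extra A is paid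
    only when P <= A, since otherwise the left side is 0. *)
Lemma logn_fact_compare p A B : prime p -> (A <= B)%N ->
  (B * logn p A`! <= A * logn p B`! + A * npow p A)%N.
Proof.
move=> pp AB; rewrite !logn_fact // /npow.
apply: (@leq_trans (A * (\sum_(1 <= k < A.+1) B %/ p ^ k) + A * npow p A)); last first.
  rewrite leq_add2r leq_mul2l (@big_cat_nat _ _ _ A.+1 1 B.+1) //= ?leq_addr ?orbT //.
rewrite /npow -mulnDr -big_split /= !big_distrr /=; apply: leq_sum => k _.
have P0 : (0 < p ^ k)%N by rewrite expn_gt0 prime_gt0.
case: (leqP (p ^ k) A) => hP; last by rewrite [X in (_ * X <= _)%N]divn_small ?muln0.
move: (p ^ k)%N P0 hP => P P0 hP.
have h1 := leq_trunc_div A P; have h2 := ltn_ceil B P0.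
rewrite -(leq_pmul2r P0); nia.
Qed.

(** Stirling turns A ln B! - B ln A! into A B ln (B/A), and Legendre's formula splits it over
    primes. A prime above A contributes at least A (B/p - 1) ln p; one below A costs at most A ln p,
    plus A ln A if p <= s, as [npow p A] >= 2 needs p ^ 2 <= A. Thus every prime pays A ln p once,
    and a single Chebyshev bound gives the constant ln 4; subtracting two separate Mertens estimates
    would lose more. *)
Lemma mertens A B s : (0 < A <= B)%N -> (A <= s ^ 2)%N ->
  \sum_(A.+1 <= p < B.+1 | prime p) ln p%:R / p%:R <=
  ln B%:R - ln A%:R + ln 4 + (ln B%:R + 1 + s%:R * ln A%:R) / B%:R :> R.
Proof.
move=> /andP[A0 AB] As.
have B0 : (0 < B)%N by exact: leq_trans AB.
have a0 : 0 < A%:R :> R by rewrite ltr0n.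
have b0 : 0 < B%:R :> R by rewrite ltr0n.
have key : A%:R * B%:R * (\sum_(A.+1 <= p < B.+1 | prime p) ln p%:R / p%:R) <=
   A%:R * ln B`!%:R - B%:R * ln A`!%:R +
   A%:R * (\sum_(0 <= p < B.+1 | prime p) ln p%:R + s%:R * ln A%:R) :> R.
  rewrite (@ln_fact_logn B B) // (@ln_fact_logn A B) // !mulr_sumr -sumrB.
  have -> : \sum_(0 <= p < B.+1) (A%:R * ((logn p B`!)%:R * ln p%:R) -
        B%:R * ((logn p A`!)%:R * ln p%:R)) =
     \sum_(0 <= p < B.+1 | prime p) (A%:R * ((logn p B`!)%:R * ln p%:R) -
        B%:R * ((logn p A`!)%:R * ln p%:R)) :> R.
    rewrite [RHS]big_mkcond; apply: eq_bigr => p _; case: ifP => // pp.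
    have e m : logn p m = 0%N by rewrite lognE pp.
    by rewrite !e !mul0r !mulr0 subrr.
  have -> : \sum_(A.+1 <= p < B.+1 | prime p) A%:R * B%:R * (ln p%:R / p%:R) =
    \sum_(0 <= p < B.+1 | prime p) (A < p)%:R * (A%:R * B%:R * (ln p%:R / p%:R)) :> R.
    rewrite [RHS](@big_cat_nat _ _ _ A.+1) //=.
    rewrite [X in _ = X + _]big_nat_cond [X in _ = X + _]big1 ?add0r.
      rewrite big_nat_cond [RHS]big_nat_cond.
      by apply: eq_bigr => p /andP[/andP[-> _] _]; rewrite mul1r.
    by move=> p /andP[/andP[_ h] _]; rewrite ltnNge -ltnS h mul0r.
  have sqrt_part : \sum_(0 <= p < B.+1 | prime p) ((p <= s)%N%:R * ln A%:R) <= s%:R * ln A%:R :> R.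
    rewrite -mulr_suml ler_wpM2r ?ln_nat_ge0 // -natr_sum ler_nat.
    apply: (@leq_trans (\sum_(0 <= p < B.+1) (0 < p <= s)%N)).
      rewrite [leqLHS]big_mkcond; apply: leq_sum => p _; case: ifP => // /prime_gt0 -> //=.
    have E N : (\sum_(0 <= p < N.+1) (0 < p <= s) = minn N s)%N.
      elim: N => [|N IH]; first by rewrite big_nat1 min0n.
      by rewrite big_nat_recr //= IH; lia.
    by rewrite E geq_minr.
  apply: (@le_trans _ _ (\sum_(0 <= p < B.+1 | prime p)
     ((A%:R * ((logn p B`!)%:R * ln p%:R) - B%:R * ((logn p A`!)%:R * ln p%:R)) +
      A%:R * (ln p%:R + (p <= s)%N%:R * ln A%:R)))); last first.
    rewrite big_split /= lerD2l -mulr_sumr ler_pM2l // big_split /= lerD2l //.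
  apply: ler_sum => p pp.
  have lp : 0 <= ln (p%:R : R) := ln_nat_ge0 p.
  have lA : 0 <= ln (A%:R : R) := ln_nat_ge0 A.
  have p0 : 0 < p%:R :> R by rewrite ltr0n prime_gt0.
  case: (ltnP A p) => hAp.
    rewrite mul1r.
    have -> : logn p A`! = 0%N.
      rewrite logn_fact // big_nat big1 // => k /andP[k1 _].
      rewrite divn_small //; apply: leq_trans hAp _.
      by rewrite -[X in (X <= _)%N](expn1 p) leq_pexp2l // prime_gt0.
    rewrite mul0r mulr0 subr0.
    have h : B%:R / p%:R <= (logn p B`!)%:R + 1 :> R.
      rewrite ler_pdivrMr // natr1 -natrM ler_nat logn_fact // big_nat_recl // expn1.
      by apply: leq_trans (ltnW (ltn_ceil B (prime_gt0 pp))) _; rewrite leq_mul2r ltnS leq_addr orbT.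
    have h2 : A%:R * ln p%:R * (B%:R / p%:R) <= A%:R * ln p%:R * ((logn p B`!)%:R + 1) :> R.
      by rewrite ler_wpM2l // mulr_ge0 // ltW.
    have h3 : 0 <= A%:R * ((p <= s)%N%:R * ln A%:R) :> R by rewrite !mulr_ge0 // ltW.
    lra.
  rewrite mul0r.
  have h1 : B%:R * (logn p A`!)%:R <= A%:R * (logn p B`!)%:R + A%:R * (npow p A)%:R :> R.
    by rewrite -!natrM -natrD ler_nat logn_fact_compare.
  have h2 : (npow p A)%:R * ln p%:R <= ln p%:R + (p <= s)%N%:R * ln A%:R :> R.
    case: (leqP p s) => hps.
      by rewrite mul1r (le_trans (npow_ln _ pp)) // lerDr.
    rewrite mul0r addr0 -[leRHS]mul1r ler_wpM2r // lern1 npow_le1 //.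
    by apply: leq_ltn_trans As _; rewrite ltn_sqr.
  have h3 := ler_wpM2r lp h1.
  have h4 := ler_wpM2l (ltW a0) h2.
  lra.
have th := theta_le B.
have fA := ln_fact_ge A.
have fB : ln (B`!%:R : R) <= B%:R * ln B%:R + ln B%:R - B%:R + 1.
  case: B B0 {AB b0 key th} => // B _; have := ln_fact_le B.
  move: (ln B.+1%:R) (ln _`!%:R) => u w.
  by rewrite -(natr1 B.+1) -(natr1 B) => *; lra.
rewrite -(ler_pM2l (mulr_gt0 a0 b0)); apply: le_trans key _.
have -> : A%:R * B%:R * (ln B%:R - ln A%:R + ln 4 + (ln B%:R + 1 + s%:R * ln A%:R) / B%:R)
  = A%:R * (B%:R * ln B%:R + ln B%:R - B%:R + 1) - B%:R * (A%:R * ln A%:R - A%:R)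
    + A%:R * (B%:R * ln 4 + s%:R * ln A%:R) :> R.
  by field; rewrite lt0r_neq0.
apply: lerD; last by rewrite ler_pM2l // lerD2r.
by apply: lerB; rewrite ler_pM2l.
Qed.
End Mertens.

(** * The bilinear bound *)

(* [oqc_prim] is the form in which primitivity is used: it makes the Gauss sum
   at frequency n vanish unless n is coprime to q. *)
Record odd_quad_char (R : realType) (q : nat) (x : nat -> R) : Prop := OddQuadChar {
  oqc_gt1 : (1 < q)%N;
  oqc_per : forall n, x (n + q)%N = x n;
  oqc_mul : forall m n, x (m * n)%N = x m * x n;
  oqc_sqr : forall n, x n ^+ 2 = (coprime n q)%:R;
  oqc_odd : forall n, (n <= q)%N -> x (q - n)%N = - x n;
  oqc_prim : forall n, ~~ coprime n q ->
    exists c, [/\ (c * n = n %[mod q])%N, coprime c q & x c != 1] }.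

Section Periodic.
Variables (R : realType) (q : nat).
Hypothesis q0 : (0 < q)%N.

Lemma per_mod (f : nat -> R) : (forall n, f (n + q)%N = f n) ->
  forall n, f n = f (n %% q)%N.
Proof.
move=> fq n; rewrite {1}(divn_eq n q) addnC; elim: (n %/ q)%N => [|k IH].
  by rewrite addn0.
by rewrite mulSn addnCA addnC fq.
Qed.

Lemma sum_per_shift (f : nat -> R) : (forall n, f (n + q)%N = f n) ->
  forall j, \sum_(k < q) f (k + j)%N = \sum_(k < q) f k.
Proof.
move=> fq; elim=> [|j <-]; first by apply: eq_bigr => k _; rewrite addn0.
case: q q0 fq => // q' _ fq.
rewrite big_ord_recr [RHS]big_ord_recl /= addrC; congr (_ + _).
  by rewrite addnS -addSn addnC fq.
by apply: eq_bigr => k _; rewrite /bump leq0n addnS.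
Qed.

Lemma sum_per_mul (f : nat -> R) (u : nat) : (forall n, f (n + q)%N = f n) ->
  coprime u q -> \sum_(k < q) f (u * k)%N = \sum_(k < q) f k.
Proof.
move=> fq cu.
pose h (i : 'I_q) := Ordinal (ltn_pmod (u * i) q0).
have hinj : injective h.
  move=> i j [] /eqP; wlog ij : i j / (j <= i)%N => [H|].
    case: (leqP j i) => [/H//|/ltnW /H{}H]; rewrite eq_sym => /H ->//.
  rewrite eqn_mod_dvd ?leq_mul2l ?ij ?orbT // -mulnBr Gauss_dvdr 1?coprime_sym //.
  move=> d; apply/val_inj/eqP; rewrite eqn_leq ij andbT -subn_eq0.
  apply/eqP; case: (posnP (i - j)) => // hp; have := dvdn_leq hp d.
  have := ltn_ord i; lia.
rewrite [RHS](reindex_inj hinj) /=.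
by apply: eq_bigr => k _; rewrite (per_mod fq).
Qed.
End Periodic.

(** * Orthogonality of the trigonometric functions modulo q *)

Section Trig.
Variables (R : realType) (q : nat).
Hypothesis q0 : (0 < q)%N.
Definition ang : R := pi *+ 2 / q%:R.

Let qR0 : q%:R != 0 :> R. Proof. by rewrite pnatr_eq0 -lt0n. Qed.

Lemma ang_q k : ang * (k * q)%:R = pi *+ 2 *+ k.
Proof. by rewrite /ang natrM -[RHS]mulr_natr; field. Qed.

Lemma sin_ang_per m k : sin (ang * (m + k * q)%:R) = sin (ang * m%:R).
Proof. rewrite natrD mulrDr ang_q; exact: (periodicn (@sinD2pi R)). Qed.

Lemma cos_ang_per m k : cos (ang * (m + k * q)%:R) = cos (ang * m%:R).
Proof. rewrite natrD mulrDr ang_q; exact: (periodicn (@cosD2pi R)). Qed.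

Lemma sin_ang_mod m : sin (ang * m%:R) = sin (ang * (m %% q)%:R).
Proof. by rewrite {1}(divn_eq m q) addnC sin_ang_per. Qed.

Lemma cos_ang_mod m : cos (ang * m%:R) = cos (ang * (m %% q)%:R).
Proof. by rewrite {1}(divn_eq m q) addnC cos_ang_per. Qed.

(** Multiplication by sin (pi m / q), nonzero for 0 < m < q, makes the sum telescope. *)
Lemma sum_cos_ang m : (0 < m < q)%N -> \sum_(k < q) cos (ang * (k * m)%:R) = 0.
Proof.
move=> /andP[m0 mq].
pose y := pi / q%:R * m%:R : R.
have sy : sin y != 0.
  apply: lt0r_neq0; apply: sin_gt0_pi.
  rewrite /y; apply/andP; split.
    by rewrite !mulr_gt0 ?pi_gt0 ?invr_gt0 ?ltr0n.
  by rewrite -mulrA gtr_pMr ?pi_gt0 // mulrC ltr_pdivrMr ?ltr0n // mul1r ltr_nat.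
apply: (mulfI sy); rewrite mulr0 mulr_sumr.
have E N : \sum_(k < N) sin y * cos (ang * (k * m)%:R) =
           (sin (ang * (N * m)%:R - y) + sin y) / 2.
  elim: N => [|N IH]; first by rewrite big_ord0 mul0n mulr0 sub0r sinN addNr mul0r.
  rewrite big_ord_recr /= IH.
  have -> : ang * (N.+1 * m)%:R - y = ang * (N * m)%:R + y.
    rewrite mulSn natrD mulrDr /y /ang; field; exact: qR0.
  by rewrite sinB sinD; field.
rewrite E mulnC ang_q.
by rewrite [_ - y]addrC (periodicn (@sinD2pi R)) sinN addNr mul0r.
Qed.

Lemma sum_cos_angB a b : (a < q)%N -> (b < q)%N ->
  \sum_(k < q) cos (ang * (k * a)%:R - ang * (k * b)%:R) = (a == b)%:R * q%:R.
Proof.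
wlog ab : a b / (b <= a)%N => [H|] aq bq.
  case: (leqP b a) => [/H->//|/ltnW /H{}H].
  rewrite eq_sym -H //; apply: eq_bigr => k _.
  by rewrite -cosN opprB.
case: (eqVneq a b) => [->|nab].
  under eq_bigr do rewrite subrr cos0.
  by rewrite sumr_const card_ord mul1r.
rewrite mul0r -[RHS](@sum_cos_ang (a - b)); last by lia.
by apply: eq_bigr => k _; rewrite -mulrBr -natrB ?leq_mul2l ?ab ?orbT // -mulnBr.
Qed.

Lemma sum_cos_angD a b : (a < q)%N -> (b < q)%N ->
  \sum_(k < q) cos (ang * (k * a)%:R + ang * (k * b)%:R) = ((a + b) %% q == 0)%N%:R * q%:R.
Proof.
move=> aq bq.
under eq_bigr do rewrite -mulrDr -natrD -mulnDr cos_ang_mod -modnMmr -cos_ang_mod.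
case: (posnP ((a + b) %% q)) => [->|h].
  under eq_bigr do rewrite muln0 mulr0 cos0.
  by rewrite sumr_const card_ord mul1r.
by rewrite sum_cos_ang ?h ?ltn_pmod // mul0r.
Qed.

(** The bound r <= q keeps the indices distinct modulo q, so that only the diagonal a = b
    survives. *)
Lemma parseval_interval (r j : nat) : (r <= q)%N ->
  \sum_(k < q) ((\sum_(a < r) cos (ang * (k * (a + j))%:R)) ^+ 2 +
                (\sum_(a < r) sin (ang * (k * (a + j))%:R)) ^+ 2) = (r * q)%:R.
Proof.
move=> rq.
have E k : (\sum_(a < r) cos (ang * (k * (a + j))%:R)) ^+ 2 +
           (\sum_(a < r) sin (ang * (k * (a + j))%:R)) ^+ 2 =
  \sum_(a < r) \sum_(b < r) cos (ang * (k * a)%:R - ang * (k * b)%:R).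
  rewrite !expr2 !mulr_suml -big_split; apply: eq_bigr => a _.
  rewrite !mulr_sumr -big_split; apply: eq_bigr => b _ /=.
  by rewrite -cosB; congr cos; rewrite !mulnDr !natrD; ring.
under eq_bigr do rewrite E.
rewrite exchange_big /=.
under eq_bigr do rewrite exchange_big /=.
rewrite natrM -[r in RHS]card_ord -sumr_const mulr_suml.
have lq (i : 'I_r) : (i < q)%N by apply: leq_trans rq.
apply: eq_bigr => a _; rewrite (bigD1 a) //= [X in _ + X]big1 ?addr0.
  by rewrite sum_cos_angB ?eqxx.
move=> b /negPf nab; rewrite sum_cos_angB //.
by rewrite (_ : (_ == _)%N = false) ?mul0r // eq_sym.
Qed.
End Trig.

(** * The sine Gauss sum and the bound for square sums *)

Section Gauss.
Variables (R : realType) (q : nat) (x : nat -> R).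
Hypothesis hx : odd_quad_char q x.
Local Notation t := (ang R q).
Let q1 := oqc_gt1 hx.
Let q0 : (0 < q)%N := ltnW (oqc_gt1 hx).

Lemma oqc_val n : [\/ x n = 0, x n = 1 | x n = -1].
Proof.
have := oqc_sqr hx n; case: coprime => /eqP.
  by rewrite sqrf_eq1 => /orP[]/eqP->; [constructor 2|constructor 3].
by rewrite sqrf_eq0 => /eqP->; constructor 1.
Qed.

Lemma oqc_1 : x 1%N = 1.
Proof.
have := oqc_sqr hx 1; rewrite coprime1n => h.
have := oqc_mul hx 1 1; rewrite muln1 => e.
by rewrite e -expr2 h.
Qed.

Lemma oqc_norm n : `|x n| <= 1.
Proof. by case: (oqc_val n) => ->; rewrite ?normrN ?normr0 ?normr1. Qed.

(** Imaginary part of the Gauss sum at frequency n; the cosine part is 0 because x is odd. *)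
Definition sgauss n := \sum_(k < q) x k * sin (t * (k * n)%:R).

Lemma sgauss_perk n k : x (k + q)%N * sin (t * ((k + q) * n)%:R) = x k * sin (t * (k * n)%:R).
Proof. by rewrite (oqc_per hx) mulnDl [(q * n)%N]mulnC sin_ang_per. Qed.

(** For n coprime to q, substitute n k for k. Otherwise x n = 0, and substituting c k, with c from
    [oqc_prim], gives sgauss n = x c * sgauss n with x c <> 1. *)
Lemma sgaussE n : sgauss n = x n * sgauss 1.
Proof.
case: (boolP (coprime n q)) => [cn|/[dup] ncn /(oqc_prim hx)[c [cnn cc xc]]].
  have xx : x n * x n = 1 by rewrite -expr2 (oqc_sqr hx) cn.
  rewrite -[LHS]mul1r -xx -mulrA; congr (_ * _).
  rewrite /sgauss -(@sum_per_mul _ _ q0 _ n (sgauss_perk 1)) // mulr_sumr.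
  by apply: eq_bigr => k _; rewrite (oqc_mul hx) mulrA muln1 [(k * n)%N]mulnC.
have -> : x n = 0.
  by apply/eqP; rewrite -sqrf_eq0 (oqc_sqr hx) (negPf ncn).
rewrite mul0r; apply/eqP.
have : sgauss n = x c * sgauss n.
  rewrite {1}/sgauss -(@sum_per_mul _ _ q0 _ c (sgauss_perk n)) // mulr_sumr.
  apply: eq_bigr => k _; rewrite (oqc_mul hx) -mulrA; congr (_ * (_ * _)).
  rewrite sin_ang_mod // [(c * k)%N]mulnC -mulnA -modnMmr cnn modnMmr.
  by rewrite -sin_ang_mod.
move/eqP; rewrite -subr_eq0 -{1}[sgauss n]mul1r -mulrBl mulf_eq0 subr_eq0 eq_sym.
by rewrite (negPf xc).
Qed.

(** The sum of sgauss n ^ 2 over a period is computed twice: by [sgaussE], and by orthogonality,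
    where for each k only l = k and l = q - k remain and contribute equally because x is odd. *)
Lemma sgauss_sqr : sgauss 1 ^+ 2 = q%:R.
Proof.
have x0 : x 0%N = 0.
  by apply/eqP; rewrite -sqrf_eq0 (oqc_sqr hx) /coprime gcd0n gtn_eqF.
have S0 : 0 < \sum_(n < q) x n ^+ 2.
  rewrite (bigD1 (Ordinal q1)) //= oqc_1 expr1n ltr_pwDl ?ltr01 //.
  by apply: sumr_ge0 => i _; exact: sqr_ge0.
apply: (mulIf (lt0r_neq0 S0)).
transitivity (\sum_(n < q) sgauss n ^+ 2).
  by rewrite mulr_sumr; apply: eq_bigr => n _; rewrite [sgauss n]sgaussE exprMn mulrC.
have E n : sgauss n ^+ 2 = \sum_(k < q) \sum_(l < q) x k * x l *
    ((cos (t * (n * k)%:R - t * (n * l)%:R) - cos (t * (n * k)%:R + t * (n * l)%:R)) / 2).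
  rewrite expr2 mulr_suml; apply: eq_bigr => k _; rewrite mulr_sumr; apply: eq_bigr => l _.
  by rewrite cosB cosD [(k * n)%N]mulnC [(l * n)%N]mulnC; field.
under eq_bigr do rewrite E.
rewrite exchange_big mulr_sumr; apply: eq_bigr => k _ /=.
rewrite exchange_big /=.
have E2 (l : 'I_q) : \sum_(n < q) x k * x l * ((cos (t * (n * k)%:R - t * (n * l)%:R)
     - cos (t * (n * k)%:R + t * (n * l)%:R)) / 2) =
   x k * x l * (((k == l)%:R - ((k + l) %% q == 0)%N%:R) * q%:R / 2).
  rewrite -mulr_sumr -mulr_suml sumrB sum_cos_angB // sum_cos_angD // -mulrBl.
  by rewrite (_ : (val k == val l) = (k == l)).
under eq_bigr do rewrite E2.
case: (posnP k) => [k0|k0].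
  by rewrite k0 x0 expr0n mulr0 big1 // => l _; rewrite !mul0r.
have kq : (q - k < q)%N by lia.
have nk : ((k + (q - k)) %% q == 0)%N by rewrite subnKC ?modnn // ltnW.
(* If k = q - k the two surviving terms collide, but then x k = - x k = 0. *)
case: (eqVneq (Ordinal kq) k) => [e|ne].
  have : x k = - x k by rewrite -(oqc_odd hx) ?[in LHS]/= 1?ltnW // -[in LHS]e.
  move/eqP; rewrite -addr_eq0 -mulr2n mulrn_eq0 /= => /eqP ->.
  by rewrite expr0n mulr0 big1 // => l _; rewrite !mul0r.
rewrite (bigD1 k) //= (bigD1 (Ordinal kq)) //= big1 => [|l /andP[/negPf lk /negPf lq]].
  rewrite eqxx nk (_ : (k == Ordinal kq) = false) ?[k == _]eq_sym ?(negPf ne) //.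
  rewrite (_ : ((k + k) %% q == 0)%N = false); last first.
    apply/negP => /dvdnP[j hj]; move/eqP: ne; apply; apply/val_inj => /=.
    have := ltn_ord k; case: j hj => [|[|j]] hj; nia.
  rewrite (oqc_odd hx) ?[(k <= q)%N]ltnW // addr0 expr2.
  by rewrite (_ : true%:R = 1 :> R) // (_ : false%:R = 0 :> R) //; field.
rewrite [k == l]eq_sym lk (_ : ((k + l) %% q == 0)%N = false) ?subrr ?mul0r ?mulr0 //.
apply/negP => /dvdnP[j hj]; move/eqP: lq; apply; apply/val_inj => /=.
have := ltn_ord k; have := ltn_ord l; case: j hj => [|[|j]] hj; nia.
Qed.

(** Multiplication by q - 1 permutes the residues and changes the sign of x. *)
Lemma sum_oqc_period j : \sum_(k < q) x (k + j)%N = 0.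
Proof.
rewrite sum_per_shift //; last exact: (oqc_per hx).
have x1 : x (q - 1)%N = -1 by rewrite (oqc_odd hx) // oqc_1.
have cq : coprime (q - 1) q.
  have := oqc_sqr hx (q - 1); rewrite x1 sqrrN expr1n; case: coprime => // /eqP.
  by rewrite oner_eq0.
have := @sum_per_mul _ _ q0 _ _ (oqc_per hx) cq.
under eq_bigr do rewrite (oqc_mul hx) x1 mulN1r.
rewrite sumrN => /eqP; rewrite eq_sym -addr_eq0 -mulr2n mulrn_eq0 => /eqP //.
Qed.

Definition sqsum r := \sum_(a < r) \sum_(b < r) x (a + b).+1.

(** After [sgaussE] the sine of k (a + (b + 1)) splits by the addition formula into a product of two
    interval sums, one started at 0 and one at 1. The inequality 2 u v <= u ^ 2 + v ^ 2 and Parseval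
    on each interval finish. *)
Lemma sqsum_small r : (r <= q)%N -> `|sqsum r| <= Num.sqrt q%:R * r%:R.
Proof.
move=> rq.
have ht : `|sgauss 1| = Num.sqrt q%:R by rewrite -sgauss_sqr sqrtr_sqr.
have sq0 : 0 < Num.sqrt (q%:R : R) by rewrite sqrtr_gt0 ltr0n.
pose CA k := \sum_(a < r) cos (t * (k * (a + 0))%:R).
pose SA k := \sum_(a < r) sin (t * (k * (a + 0))%:R).
pose CB k := \sum_(a < r) cos (t * (k * (a + 1))%:R).
pose SB k := \sum_(a < r) sin (t * (k * (a + 1))%:R).
have E : sgauss 1 * sqsum r = \sum_(k < q) x k * (SA k * CB k + CA k * SB k).
  rewrite /sqsum mulr_sumr.
  under eq_bigr => a _.
    rewrite mulr_sumr; under eq_bigr => b _ do rewrite mulrC -sgaussE /sgauss.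
    rewrite exchange_big; over.
  rewrite exchange_big; apply: eq_bigr => k _ /=.
  rewrite !mulr_suml -big_split mulr_sumr; apply: eq_bigr => a _ /=.
  rewrite !mulr_sumr -big_split mulr_sumr; apply: eq_bigr => b _ /=.
  by rewrite -sinD -mulrDr -natrD -mulnDr; congr (_ * sin (_ * (_ * _)%:R)); lia.
have : `|sgauss 1 * sqsum r| <= (r * q)%:R.
  rewrite E; apply: le_trans (ler_norm_sum _ _ _) _.
  have -> : (r * q)%:R = \sum_(k < q) ((CA k ^+ 2 + SA k ^+ 2) + (CB k ^+ 2 + SB k ^+ 2)) / 2.
    by rewrite -mulr_suml big_split /= !parseval_interval //; field.
  apply: ler_sum => k _; rewrite normrM -[leRHS]mul1r.
  apply: ler_pM; rewrite ?normr_ge0 ?oqc_norm //.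
  move: (SA k) (CB k) (CA k) (SB k) => a b c d.
  have := sqr_ge0 (a - b); have := sqr_ge0 (c - d).
  have := sqr_ge0 (a + b); have := sqr_ge0 (c + d).
  by rewrite ler_norml => *; apply/andP; split; nra.
have eq : q%:R = Num.sqrt (q%:R : R) * Num.sqrt q%:R by rewrite -expr2 sqr_sqrtr ?ler0n.
by rewrite normrM ht natrM {2}eq mulrCA ler_pM2l // mulrC.
Qed.

(** A full period in either variable sums to 0; this removes the restriction r <= q. *)
Lemma sqsum_addq r : sqsum (r + q) = sqsum r.
Proof.
have E a n : \sum_(b < n + q) x (a + b).+1 = \sum_(b < n) x (a + b).+1.
  rewrite big_split_ord /= -[RHS]addr0; congr (_ + _).
  rewrite -[RHS](sum_oqc_period (a + n).+1); apply: eq_bigr => k _; congr x; lia.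
rewrite /sqsum; under eq_bigr do rewrite E.
rewrite exchange_big /= [RHS]exchange_big /=; apply: eq_bigr => b _.
have C n : \sum_(i < n) x (i + b).+1 = \sum_(i < n) x (b + i).+1.
  by apply: eq_bigr => i _; rewrite addnC.
by rewrite !C E.
Qed.

Theorem sqsum_le r : `|sqsum r| <= Num.sqrt q%:R * r%:R.
Proof.
have -> : sqsum r = sqsum (r %% q)%N by apply: per_mod => n; exact: sqsum_addq.
apply: le_trans (sqsum_small (ltnW (ltn_pmod r q0))) _.
by rewrite ler_wpM2l ?sqrtr_ge0 // ler_nat leq_mod.
Qed.
End Gauss.

(** * Passing to a real-valued function *)

Lemma coprime_lift (d q m : nat) : (0 < q)%N -> (d %| q)%N -> coprime m d ->
  exists k, coprime (m + k * d) q.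
Proof.
move=> q0 dq cmd; case: (posnP m) => [m0|m0].
  move: cmd; rewrite m0 /coprime gcd0n => /eqP ->; exists 1%N.
  by rewrite add0n muln1 gcd1n.
(* The multiplier k is the part of q prime to m: a prime p of q dividing m divides neither k nor d,
   while one not dividing m divides k. Either way p does not divide m + k d. *)
exists (q`_(\pi(m)^'))%N; rewrite coprime_has_primes //; last by rewrite addn_gt0 m0.
apply/hasPn => p pq; apply/negP; rewrite !mem_primes in pq *.
case/and3P: pq => pp _ pq /and3P[_ _ pd].
have ppart : (p %| q`_(\pi(m)^'))%N = ~~ (p %| m)%N.
  have -> : (p %| q`_(\pi(m)^'))%N = (p \in primes (q`_(\pi(m)^'))).
    by rewrite mem_primes pp part_gt0.
  have pim : (p \in \pi(m)) = (p %| m)%N by rewrite -[LHS]/(p \in primes m) mem_primes pp m0.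
  by rewrite primes_part mem_filter mem_primes pp q0 pq !andbT -pim inE.
case: (boolP (p %| m)%N) ppart => pm /= ppart.
  have : (p %| (q`_(\pi(m)^')) * d)%N by rewrite -(dvdn_addr _ pm).
  rewrite Euclid_dvdM // ppart /= => pd'.
  have : (p %| gcdn m d)%N by rewrite dvdn_gcd pm.
  by rewrite (eqP cmd) dvdn1 => /eqP p1; rewrite p1 in pp.
by move: pd; rewrite dvdn_addl ?dvdn_mulr ?ppart // (negPf pm).
Qed.

Section FromDefs.
Variables (R : realType) (q : nat) (chi : int -> R[i]).
Hypotheses (q1 : (1 < q)%N) (hchar : dirichlet_character q chi).
Hypotheses (hreal : forall n, chi n \is Num.real).
Hypotheses (hodd : odd_character chi) (hprim : primitive q chi).

Definition rchar (n : nat) : R := complex.Re (chi n%:Z).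

Lemma rcharE n : chi n%:Z = (rchar n)%:C%C.
Proof. by rewrite /rchar RRe_real. Qed.

Let q0 : (0 < q)%N := ltnW q1.
Let chiq : forall n, chi (n + q%:Z) = chi n. Proof. by case: hchar. Qed.
Let chiM : forall m n, chi (m * n) = chi m * chi n. Proof. by case: hchar. Qed.
Let chiN0 : forall n, (chi n != 0) = coprimez n q%:Z. Proof. by case: hchar. Qed.

Lemma chi_mod (a b : int) : (a = b %[mod q%:Z])%Z -> chi a = chi b.
Proof.
have P (c : int) (k : nat) : chi (c + k%:Z * q%:Z) = chi c.
  elim: k => [|k IH]; first by rewrite mul0r addr0.
  by rewrite -addn1 PoszD mulrDl mul1r addrA chiq.
have H c : chi c = chi (c %% q%:Z)%Z.
  rewrite {1}(divz_eq c q%:Z); case: (c %/ q%:Z)%Z => k.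
    by rewrite addrC P.
  by rewrite NegzE mulNr -[LHS](P _ k.+1) [X in chi X]addrC addrA subrr add0r.
by move=> ab; rewrite H ab -H.
Qed.

Lemma chi1 : chi 1 = 1.
Proof.
have h : chi 1 != 0 by rewrite chiN0 coprimezE coprime1n.
by apply: (mulfI h); rewrite -chiM !mulr1.
Qed.

Lemma chi_natmod (a b : nat) : a = b %[mod q] -> chi a%:Z = chi b%:Z.
Proof. by move=> ab; apply: chi_mod; rewrite !modz_nat ab. Qed.

(** If no such c exists, chi is 1 on every unit congruent to 1 modulo q' = q / gcd (n, q), because
    such a unit fixes n modulo q. Then chi on the units depends only on the class modulo q', and
    since units modulo q' lift to units modulo q it induces a character psi modulo q' < q, against
    primitivity. *)
Lemma rchar_prim n : ~~ coprime n q ->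
  exists c, [/\ (c * n = n %[mod q])%N, coprime c q & rchar c != 1].
Proof.
move=> ncn; apply: contrapT => nex.
pose d := gcdn n q; pose q' := (q %/ d)%N.
have d0 : (0 < d)%N by rewrite gcdn_gt0 q0 orbT.
have d1 : (1 < d)%N by rewrite ltn_neqAle eq_sym d0 andbT.
have dq : (q' * d = q)%N by rewrite divnK ?dvdn_gcdr.
have q'q : (q' %| q)%N by rewrite -dq dvdn_mulr.
have q'0 : (0 < q')%N by rewrite -(ltn_pmul2r d0) dq mul0n.
have triv c : coprime c q -> c = 1 %[mod q'] -> chi c%:Z = 1.
  move=> cc c1; rewrite rcharE; apply/eqP; apply: contrapT => hc; apply: nex.
  exists c; split => //; last by apply/negP => /eqP h; apply: hc; rewrite h.
  case: c cc c1 {hc} => [|c] cc c1.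
    by have := q1; move: cc; rewrite /coprime gcd0n => /eqP ->.
  apply/eqP; rewrite eqn_mod_dvd ?leq_pmull // -{2}[n]mul1n -mulnBl -dq.
  apply: dvdn_mul; last exact: dvdn_gcdl.
  by rewrite -eqn_mod_dvd //; apply/eqP.
have uniq k k' : coprime k q -> coprime k' q -> k = k' %[mod q'] ->
    chi k%:Z = chi k'%:Z.
  move=> ck ck' kk'.
  pose u := (k' ^ (totient q).-1)%N.
  have uk : (k' * u = 1 %[mod q])%N.
    by rewrite -expnS prednK ?totient_gt0 //; exact: cyclic.Euler_exp_totient.
  have cu : coprime u q by apply: coprimeXl.
  have uk' : (k * u = 1 %[mod q'])%N.
    rewrite -modnMml kk' modnMml -(modn_dvdm _ q'q) uk modn_dvdm //.
  have e1 := triv _ _ uk'; rewrite coprimeMl ck cu in e1.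
  have e2 : chi (k' * u)%N%:Z = 1 by rewrite (chi_natmod uk) chi1.
  have h : chi u%:Z != 0 by rewrite chiN0.
  by apply: (mulIf h); rewrite -!chiM -!PoszM e1 ?e2.
have : forall m : int, exists y : R[i],
    if coprimez m q'%:Z then
      (exists k : nat, [/\ coprime k q, (k%:Z = m %[mod q'%:Z])%Z & y = chi k%:Z])
    else y = 0.
  move=> m; case: (boolP (coprimez m q'%:Z)) => [cm|_]; last by exists 0.
  pose m' := `|(m %% q'%:Z)%Z|%N.
  have em' : m'%:Z = (m %% q'%:Z)%Z by rewrite /m' gez0_abs // modz_ge0 // -lt0n.
  have cm' : coprime m' q'.
    by rewrite -[coprime _ _]/(coprimez m'%:Z q'%:Z) em' /coprimez gcdz_modl.
  have [k hk] := coprime_lift q0 q'q cm'.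
  exists (chi (m' + k * q')%N%:Z), (m' + k * q')%N; split => //.
  by rewrite PoszD PoszM addrC modzMDl em' modz_mod.
move/choice => [psi hpsi].
have q'lt : (q' < q)%N by rewrite -dq ltn_Pmulr.
have hd : dirichlet_character q' psi.
  split.
  + move=> m; have := hpsi m; have := hpsi (m + q'%:Z).
    have -> : coprimez (m + q'%:Z) q'%:Z = coprimez m q'%:Z.
      by rewrite /coprimez -gcdz_modl modzDr gcdz_modl.
    case: ifP => _; last by move=> -> ->.
    move=> [k [ck ek ->]] [l [cl el ->]]; apply: uniq => //.
    by apply/eqP; rewrite -eqz_nat -!modz_nat ek el modzDr.
  + move=> m n'; have := hpsi m; have := hpsi n'; have := hpsi (m * n').
    rewrite coprimezMl; case: coprimez; case: coprimez => /=;
      try by [move=> -> _ ->; rewrite mul0r | move=> -> -> _; rewrite mulr0].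
    move=> [j [cj ej ->]] [k [ck ek ->]] [l [cl el ->]].
    rewrite -chiM -PoszM; apply: uniq; rewrite ?coprimeMl ?cl //.
    by apply/eqP; rewrite -eqz_nat -!modz_nat PoszM ej -modzMm -ek -el modzMm.
  + move=> m; have := hpsi m; case: ifP => [_|_ ->]; last by rewrite eqxx.
    by move=> [k [ck _ ->]]; rewrite chiN0.
apply: (@hprim q' psi q'q q'lt hd) => m cm; have := hpsi m.
  rewrite (coprimez_dvdr q'q cm) => -[k [ck ek ->]].
  pose m' := `|(m %% q%:Z)%Z|%N.
  have em' : m'%:Z = (m %% q%:Z)%Z by rewrite /m' gez0_abs // modz_ge0 // -lt0n.
  have -> : chi m = chi m'%:Z by apply: chi_mod; rewrite em' modz_mod.
  apply: uniq => //.
    by rewrite -[coprime _ _]/(coprimez m'%:Z q%:Z) em' /coprimez gcdz_modl.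
  apply/eqP; rewrite -eqz_nat -!modz_nat ek em'; apply/eqP.
  rewrite -[LHS](modzMDl ((m %/ q%:Z)%Z * d%:Z)); congr (_ %% _)%Z.
  by rewrite [RHS](divz_eq m q%:Z) -mulrA -PoszM [(d * q')%N]mulnC dq.
Qed.

Lemma rchar_oqc : odd_quad_char q rchar.
Proof.
split => //.
- by move=> n; rewrite /rchar PoszD chiq.
- move=> m n; apply: (@complexI R).
  by rewrite -rcharE PoszM chiM !rcharE -rmorphM.
- move=> n; case: (boolP (coprime n q)) => cn; last first.
    have : chi n%:Z == 0 by rewrite -[_ == 0]negbK chiN0.
    by rewrite /rchar => /eqP ->; rewrite expr0n.
  (* By Euler's theorem the value is a root of unity; being real, it is 1 or -1. *)
  have : rchar n ^+ totient q = 1.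
    apply: (@complexI R); rewrite rmorphXn /= -rcharE.
    have E k : chi (n ^ k)%N%:Z = chi n%:Z ^+ k.
      by elim: k => [|k IH]; rewrite ?chi1 // expnS PoszM chiM IH exprS.
    rewrite -E (@chi_natmod _ 1) ?chi1 //; exact: cyclic.Euler_exp_totient.
  move/(congr1 Num.norm)/eqP; rewrite normrX normr1 pexpr_eq1 ?totient_gt0 //.
  by move/eqP => h; rewrite -real_normK ?num_real // h expr1n.
- move=> n nq; apply: (@complexI R); rewrite rmorphN /= -!rcharE.
  rewrite -subzn // addrC chiq -[(- n%:Z)%R]mulN1r chiM hodd mulN1r //.
- exact: rchar_prim.
Qed.
End FromDefs.

(** * The weights *)

Section Weights.
Variable R : realType.
Implicit Types (k n a b r N : nat).

(** A hat is homogeneous of degree 1 in (k, n), so reproducing 1/n calls for weights of order 1/k^3.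
    This discrete form makes the sums against 1, k and 2k - n telescope. As 0^-1 = 0, it vanishes at
    k = 0 and k = 1. *)
Definition cw k : R := ((k%:R - 1) * k%:R * (k%:R + 1))^-1.

Lemma natr_ge2 k : (2 <= k)%N -> 2 <= k%:R :> R.
Proof. by move=> h; rewrite (ler_nat R 2). Qed.

Lemma cw_ge0 k : 0 <= cw k.
Proof.
case: k => [|k]; first by rewrite /cw mulr0 mul0r invr0.
by rewrite /cw invr_ge0 -natr1 addrK !mulr_ge0 // ?addr_ge0 // ?ler0n.
Qed.

Lemma sum_cw a b : (2 <= a <= b)%N ->
  \sum_(a <= k < b) cw k = (2 * a%:R * (a%:R - 1))^-1 - (2 * b%:R * (b%:R - 1))^-1.
Proof.
move=> /andP[a2 ab]; rewrite -(subnKC ab); elim: (b - a)%N => [|d IH].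
  by rewrite addn0 big_geq // subrr.
rewrite addnS big_nat_recr ?leq_addr //= IH /cw -(natr1 (a + d)).
have : 2 <= (a + d)%:R :> R by apply: natr_ge2; lia.
have : 2 <= a%:R :> R by exact: natr_ge2.
move: (a + d)%:R a%:R => y z hz hy; field.
by rewrite !lt0r_neq0 //; lra.
Qed.

Lemma sum_cwk a b : (2 <= a <= b)%N ->
  \sum_(a <= k < b) cw k * k%:R =
  ((a%:R - 1)^-1 + a%:R^-1 - (b%:R - 1)^-1 - b%:R^-1) / 2.
Proof.
move=> /andP[a2 ab]; rewrite -(subnKC ab); elim: (b - a)%N => [|d IH].
  by rewrite addn0 big_geq //; ring.
rewrite addnS big_nat_recr ?leq_addr //= IH /cw -(natr1 (a + d)).
have : 2 <= (a + d)%:R :> R by apply: natr_ge2; lia.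
have : 2 <= a%:R :> R by exact: natr_ge2.
move: (a + d)%:R a%:R => y z hz hy; field.
by rewrite !lt0r_neq0 //; lra.
Qed.

(** Discrete antiderivative: Qw n k - Qw n (k + 1) = cw k * (2k - n), the descending side of the
    hat. *)
Definition Qw (n k : R) : R := (4 * k - 2 - n) / (2 * k * (k - 1)).

Lemma sum_cw_lin (x : R) a b : (2 <= a <= b)%N ->
  \sum_(a <= k < b) cw k * (2 * k%:R - x) = Qw x a%:R - Qw x b%:R.
Proof.
move=> /andP[a2 ab]; rewrite -(subnKC ab); elim: (b - a)%N => [|d IH].
  by rewrite addn0 big_geq // subrr.
rewrite addnS big_nat_recr ?leq_addr //= IH /cw /Qw -(natr1 (a + d)).
have : 2 <= (a + d)%:R :> R by apply: natr_ge2; lia.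
have : 2 <= a%:R :> R by exact: natr_ge2.
move: (a + d)%:R a%:R => y z hz hy; field.
by rewrite !lt0r_neq0 //; lra.
Qed.

Definition phi r N n : R := \sum_(r <= k < N) cw k * (hat k n)%:R.

Lemma phi_small r N n : (2 <= r <= N)%N -> (n <= r)%N ->
  phi r N n = n%:R * ((2 * r%:R * (r%:R - 1))^-1 - (2 * N%:R * (N%:R - 1))^-1).
Proof.
move=> rN nr; rewrite -sum_cw // /phi mulr_sumr.
by apply: eq_big_nat => k /andP[hk _]; rewrite mulrC (_ : hat k n = n) // /hat; lia.
Qed.

(** The hat at n is 0 for k below n/2, is 2k - n up to k = n, and is n afterwards; [uphalf n] is the
    first k of the middle range. *)
Lemma phi_large r N n : (2 <= r <= n)%N -> (n < N)%N ->
  phi r N n = Qw n%:R (maxn r (uphalf n))%:R - n%:R^-1 - n%:R / (2 * N%:R * (N%:R - 1)).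
Proof.
move=> rn nN; pose a := maxn r (uphalf n); rewrite -/a.
have ha : (2 <= a <= n)%N by rewrite /a; lia.
rewrite /phi (@big_cat_nat _ _ _ a) /=; [|rewrite /a; lia|lia].
rewrite big_nat big1 ?add0r; last first.
  by move=> k hk; rewrite (_ : hat k n = 0%N) ?mulr0 // /hat; move: hk; rewrite /a; lia.
rewrite (@big_cat_nat _ _ _ n) /=; [|lia|lia].
have -> : \sum_(a <= k < n) cw k * (hat k n)%:R = \sum_(a <= k < n) cw k * (2 * k%:R - n%:R).
  apply: eq_big_nat => k hk; congr (_ * _).
  have -> : hat k n = (2 * k - n)%N by rewrite /hat; move: hk; rewrite /a; lia.
  by rewrite natrB ?natrM //; move: hk; rewrite /a; lia.
rewrite sum_cw_lin //.
have -> : \sum_(n <= k < N) cw k * (hat k n)%:R = n%:R * \sum_(n <= k < N) cw k.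
  rewrite mulr_sumr; apply: eq_big_nat => k hk; rewrite mulrC.
  by rewrite (_ : hat k n = n) // /hat; lia.
rewrite sum_cw; last by lia.
rewrite /Qw.
have : 2 <= N%:R :> R by apply: natr_ge2; lia.
have : 2 <= n%:R :> R by apply: natr_ge2; lia.
have : 2 <= a%:R :> R by apply: natr_ge2; lia.
move: a%:R n%:R N%:R => x y z hx hy hz; field.
by rewrite !lt0r_neq0 //; lra.
Qed.

(** The share of 1/n which the hats of radius at least r leave uncovered: [wt r n] is the closed
    form of 1/n minus the untruncated hat sum for n < 2r - 1. It is 0 from n = 2r - 2 on. *)
Definition eta r n : R :=
  if (n <= r)%N then 1 - n%:R ^+ 2 / (2 * r%:R * (r%:R - 1))
  else if (n <= r.*2 - 2)%N then
    (2 * r%:R - n%:R) * (2 * r%:R - 2 - n%:R) / (2 * r%:R * (r%:R - 1))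
  else 0.

Definition wt r n : R := eta r n / n%:R.

Lemma phi_wt r N n : (2 <= r)%N -> (0 < n < r.*2.-1)%N -> (r.*2 < N)%N ->
  phi r N n = n%:R^-1 - wt r n - n%:R / (2 * N%:R * (N%:R - 1)).
Proof.
move=> r2 hn hN.
have y1 : 1 <= n%:R :> R by rewrite ler1n; lia.
have hz : 2 <= N%:R :> R by apply: natr_ge2; lia.
have hx : 2 <= r%:R :> R by exact: natr_ge2.
case: (leqP n r) => nr.
  rewrite phi_small //; last by lia.
  rewrite /wt /eta nr.
  move: n%:R r%:R N%:R y1 hx hz => y x z *; field.
  by rewrite !lt0r_neq0 //; lra.
rewrite phi_large //; [|lia|lia].
rewrite (_ : maxn r (uphalf n) = r); last by lia.
rewrite /wt /eta leqNgt nr /= (_ : (n <= r.*2 - 2)%N) /Qw; last by lia.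
move: n%:R r%:R N%:R y1 hx hz => y x z *; field.
by rewrite !lt0r_neq0 //; lra.
Qed.

(* [phi] equals 1/n up to the truncation term at even n, and overshoots by
   [2 * cw n] at odd n. *)
Lemma phi_tail r N n : (2 <= r)%N -> (r.*2.-1 <= n < N)%N ->
  0 <= phi r N n - (n%:R^-1 - n%:R / (2 * N%:R * (N%:R - 1))) <= 2 * cw n.
Proof.
move=> r2 hn; rewrite phi_large //; [|lia|lia].
have hm : maxn r (uphalf n) = uphalf n by lia.
rewrite hm.
have y1 : 3 <= n%:R :> R by rewrite (ler_nat R 3); lia.
have hz : 2 <= N%:R :> R by apply: natr_ge2; lia.
have := cw_ge0 n.
set m := uphalf n in hm *.
have m2 : 2 <= m%:R :> R by apply: natr_ge2; rewrite /m; lia.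
case: (boolP (odd n)) => on.
  have e : n%:R = 2 * m%:R - 1 :> R.
    apply/eqP; rewrite eq_sym subr_eq natr1 -natrM eqr_nat; apply/eqP.
    by rewrite /m uphalf_half on -{2}(odd_double_half n) on; lia.
  suff -> : Qw n%:R m%:R - n%:R^-1 - n%:R / (2 * N%:R * (N%:R - 1)) -
     (n%:R^-1 - n%:R / (2 * N%:R * (N%:R - 1))) = 2 * cw n by move=> h; apply/andP; split; lra.
  rewrite /Qw /cw e; move: m%:R N%:R m2 hz => y z *; field.
  by rewrite !lt0r_neq0 //; lra.
have e : n%:R = 2 * m%:R :> R.
  rewrite -natrM; congr (_%:R).
  by rewrite /m uphalf_half (negPf on) -{1}(odd_double_half n) (negPf on); lia.
suff -> : Qw n%:R m%:R - n%:R^-1 - n%:R / (2 * N%:R * (N%:R - 1)) -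
     (n%:R^-1 - n%:R / (2 * N%:R * (N%:R - 1))) = 0 by move=> h; apply/andP; split; lra.
rewrite /Qw e; move: m%:R N%:R m2 hz => y z *; field.
by rewrite !lt0r_neq0 //; lra.
Qed.

Lemma eta_ge0 r n : (2 <= r)%N -> 0 <= eta r n.
Proof.
move=> r2; have hx : 2 <= r%:R :> R by exact: natr_ge2.
have d0 : 0 < 2 * r%:R * (r%:R - 1) :> R by nra.
rewrite /eta; case: ifP => h1.
  rewrite subr_ge0 ler_pdivrMr // mul1r.
  have : n%:R <= r%:R :> R by rewrite ler_nat.
  have : 0 <= n%:R :> R by rewrite ler0n.
  nra.
case: ifP => // h2; apply: divr_ge0; last exact: ltW.
have : (n + 2)%:R <= (2 * r)%:R :> R by rewrite ler_nat; lia.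
rewrite natrD natrM; nra.
Qed.

(** The formula valid for n <= r stays a lower bound: for r < n <= 2r - 2 the numerators differ by 2
    (n - r) (n - r + 1), and beyond that range the left side is negative. *)
Lemma eta_ge r n : (2 <= r)%N -> 1 - n%:R ^+ 2 / (2 * r%:R * (r%:R - 1)) <= eta r n.
Proof.
move=> r2; have hx : 2 <= r%:R :> R by exact: natr_ge2.
have d0 : 0 < 2 * r%:R * (r%:R - 1) :> R by nra.
rewrite /eta; case: ifP => h1 //.
have y1 : r%:R + 1 <= n%:R :> R by rewrite natr1 ler_nat; lia.
case: ifP => h2.
  rewrite ler_pdivlMr // mulrBl divfK ?lt0r_neq0 //; nra.
have : (2 * r)%:R - 1 <= n%:R :> R by rewrite lerBlDr natr1 ler_nat; lia.
rewrite natrM subr_le0 ler_pdivlMr // mul1r; nra.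
Qed.

Lemma eta_dec r m n : (2 <= r)%N -> (m <= n)%N -> eta r n <= eta r m.
Proof.
move=> r2 mn; have hx : 2 <= r%:R :> R by exact: natr_ge2.
have d0 : 0 < 2 * r%:R * (r%:R - 1) :> R by nra.
have mnR : m%:R <= n%:R :> R by rewrite ler_nat.
have m0 : 0 <= m%:R :> R by rewrite ler0n.
case: (leqP n (r.*2 - 2)) => hn; last first.
  rewrite {1}/eta (_ : (n <= r)%N = false); last by lia.
  by rewrite leqNgt hn /= eta_ge0.
have hn' : (n + 2)%:R <= (2 * r)%:R :> R by rewrite ler_nat; lia.
rewrite natrD natrM in hn'.
rewrite /eta; case: (leqP n r) => h1.
  rewrite (leq_trans mn h1) lerB // ler_pM2r ?invr_gt0 //; nra.
rewrite hn; case: (leqP m r) => h2.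
  have y1 : r%:R + 1 <= n%:R :> R by rewrite natr1 ler_nat; lia.
  have : m%:R <= r%:R :> R by rewrite ler_nat.
  rewrite lerBrDr -mulrDl ler_pdivrMr // mul1r; nra.
rewrite (leq_trans mn hn) ler_pM2r ?invr_gt0 //; nra.
Qed.

Lemma wt_ge0 r n : (2 <= r)%N -> 0 <= wt r n.
Proof. by move=> r2; rewrite /wt divr_ge0 ?eta_ge0. Qed.

Lemma wt_mul r k n : (2 <= r)%N -> (0 < k)%N -> (0 < n)%N -> wt r (k * n) <= wt r n / k%:R.
Proof.
move=> r2 k0 n0; rewrite /wt natrM invfM mulrA [leRHS]mulrAC -!mulrA.
by rewrite ler_wpM2r ?mulr_ge0 ?invr_ge0 ?ler0n // eta_dec // leq_pmull.
Qed.

Lemma wt_out r n : (2 <= r)%N -> (r.*2.-1 <= n)%N -> wt r n = 0.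
Proof. by move=> r2 h; rewrite /wt /eta !ifF ?mul0r //; lia. Qed.
End Weights.

Lemma abel_le (R : realType) (x g : nat -> R) (M : R) (a b : nat) :
  (forall c, `|\sum_(a <= n < c) x n| <= M) ->
  (forall n, (a <= n < b)%N -> 0 <= g n) ->
  (forall n, (a <= n)%N -> (n.+1 < b)%N -> g n.+1 <= g n) -> (a < b)%N ->
  `|\sum_(a <= n < b) x n * g n| <= M * g a.
Proof.
move=> hM g0 gd; case: b g0 gd => // b g0 gd; rewrite ltnS => ab.
(* With the boundary term removed, the bound M (g a - g b) telescopes and can be proved by
   induction. *)
have key : `|\sum_(a <= n < b.+1) x n * g n - (\sum_(a <= n < b.+1) x n) * g b|
    <= M * (g a - g b).
  rewrite -(subnKC ab) in gd g0 *; elim: (b - a)%N gd g0 => [|d IH] gd g0.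
    by rewrite addn0 !big_nat1 !subrr mulr0 normr0.
  rewrite addnS !big_nat_recr ?leq_addr ?(leqW (leq_addr _ _)) //=.
  rewrite !big_nat_recr ?leq_addr //= in IH *.
  set X := \sum_(a <= i < a + d) x i * g i in IH *.
  set S := \sum_(a <= i < a + d) x i in IH *.
  have hS := hM (a + d).+1; rewrite big_nat_recr ?leq_addr //= -/S in hS.
  have -> : X + x (a + d)%N * g (a + d)%N + x (a + d).+1 * g (a + d).+1
      - (S + x (a + d)%N + x (a + d).+1) * g (a + d).+1 =
    (X + x (a + d)%N * g (a + d)%N - (S + x (a + d)%N) * g (a + d)%N) +
    (S + x (a + d)%N) * (g (a + d)%N - g (a + d).+1) by ring.
  apply: le_trans (ler_normD _ _) _.
  have -> : M * (g a - g (a + d).+1) = M * (g a - g (a + d)%N) + M * (g (a + d)%N - g (a + d).+1) by ring.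
  apply: lerD.
    by apply: IH => n h; [move=> h'; apply: gd => //; lia | apply: g0; lia].
  have h : 0 <= g (a + d)%N - g (a + d).+1 by rewrite subr_ge0; apply: gd; lia.
  by rewrite normrM [X in _ * X <= _]ger0_norm // ler_wpM2r.
have hS := hM b.+1; have gb : 0 <= g b by apply: g0; lia.
rewrite -[X in `|X|](subrK ((\sum_(a <= n < b.+1) x n) * g b)).
apply: le_trans (ler_normD _ _) _.
have -> : M * g a = M * (g a - g b) + M * g b by ring.
by apply: lerD => //; rewrite normrM [X in _ * X <= _]ger0_norm // ler_wpM2r.
Qed.

(** * From partial sums of L(1, chi) to the weighted sum *)

Section Lbound.
Variables (R : realType) (q : nat) (x : nat -> R).
Hypothesis hx : odd_quad_char q x.

Lemma oqc_partial a b : `|\sum_(a <= n < b) x n| <= q%:R.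
Proof.
have q0 : (0 < q)%N := ltnW (oqc_gt1 hx).
case: (leqP a b) => ab; last by rewrite big_geq ?normr0 ?ler0n // ltnW.
rewrite -(subnK ab) -{1}(add0n a) big_addn addnK.
pose P m := \sum_(i < m) x (i + a)%N.
rewrite big_mkord -/(P (b - a)%N).
have Pq m : P (m + q)%N = P m.
  rewrite /P big_split_ord /= -[RHS]addr0; congr (_ + _).
  rewrite -[RHS](sum_oqc_period hx (m + a)); apply: eq_bigr => k _; congr x; lia.
rewrite (per_mod Pq) /P; apply: le_trans (ler_norm_sum _ _ _) _.
apply: (@le_trans _ _ (\sum_(i < (b - a) %% q) 1)).
  by apply: ler_sum => i _; exact: (oqc_norm hx).
by rewrite sumr_const card_ord ler_nat ltnW // ltn_pmod.
Qed.

(** The range n < 2N contains the support of every hat of radius k < N, so [sqsum_le] applies to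
    each. With r just above sqrt q the bound is close to 1. *)
Lemma sum_phi_le r N : (2 <= r)%N -> (r < N)%N ->
  \sum_(0 <= n < N.*2) x n * phi R r N n <=
  Num.sqrt q%:R * (((r%:R - 1)^-1 + r%:R^-1) / 2).
Proof.
move=> r2 rN.
have -> : \sum_(0 <= n < N.*2) x n * phi R r N n = \sum_(r <= k < N) cw R k * sqsum x k.
  rewrite /phi; under eq_bigr do rewrite mulr_sumr.
  rewrite exchange_big /=; apply: eq_big_nat => k hk.
  rewrite /sqsum sum_hat mulr_sumr (@big_cat_nat _ _ _ k.*2) //=; last by lia.
  rewrite [X in _ + X]big_nat [X in _ + X]big1 ?addr0.
    by apply: eq_bigr => n _; rewrite mulrCA.
  by move=> n hn; rewrite (_ : hat k n = 0%N) ?mulr0 // /hat; lia.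
apply: (@le_trans _ _ (\sum_(r <= k < N) Num.sqrt q%:R * (cw R k * k%:R))).
  apply: ler_sum => k _; rewrite mulrCA ler_wpM2l ?cw_ge0 //.
  by apply: le_trans (ler_norm _) _; exact: sqsum_le.
rewrite -mulr_sumr sum_cwk; last by lia.
rewrite ler_wpM2l ?sqrtr_ge0 // ler_pM2r ?invr_gt0 //.
have : 2 <= N%:R :> R by apply: natr_ge2; lia.
move=> hN; have : 0 <= N%:R^-1 :> R by rewrite invr_ge0 ler0n.
have : 0 <= (N%:R - 1)^-1 :> R by rewrite invr_ge0; lra.
lra.
Qed.

Lemma partial_L_le r N : (2 <= r)%N -> (r.*2 < N)%N ->
  \sum_(1 <= n < N) x n / n%:R <=
  \sum_(1 <= n < r.*2.-1) x n * wt R r n +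
  Num.sqrt q%:R * (((r%:R - 1)^-1 + r%:R^-1) / 2) +
  ((2 * r%:R - 1) * (2 * r%:R - 2))^-1 + 4 * q%:R / (N%:R - 1).
Proof.
move=> r2 rN.
have hN : 2 <= N%:R :> R by apply: natr_ge2; lia.
have hr : 2 <= r%:R :> R by exact: natr_ge2.
pose cN : R := (2 * N%:R * (N%:R - 1))^-1.
pose dl n : R := phi R r N n - (n%:R^-1 - n%:R * cN).
have E1 : \sum_(1 <= n < r.*2.-1) x n / n%:R =
    \sum_(1 <= n < r.*2.-1) x n * wt R r n + \sum_(1 <= n < r.*2.-1) x n * phi R r N n
    + cN * \sum_(1 <= n < r.*2.-1) x n * n%:R.
  rewrite mulr_sumr -!big_split /=; apply: eq_big_nat => n hn.
  by rewrite phi_wt // -/cN; ring.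
have E2 : \sum_(r.*2.-1 <= n < N) x n / n%:R =
    \sum_(r.*2.-1 <= n < N) x n * phi R r N n + cN * \sum_(r.*2.-1 <= n < N) x n * n%:R
    - \sum_(r.*2.-1 <= n < N) x n * dl n.
  rewrite mulr_sumr -big_split -sumrB /=; apply: eq_big_nat => n hn.
  by rewrite /dl; ring.
have T1 : - \sum_(r.*2.-1 <= n < N) x n * dl n <= ((2 * r%:R - 1) * (2 * r%:R - 2))^-1.
  apply: (@le_trans _ _ (2 * \sum_(r.*2.-1 <= n < N) cw R n)).
    rewrite -sumrN mulr_sumr big_nat [leRHS]big_nat; apply: ler_sum => n hn.
    have /andP[d0 d1] := @phi_tail R r N n r2 hn; rewrite -/cN -/(dl n) in d0 d1.
    case: (oqc_val hx n) => ->; rewrite ?mul0r ?mul1r ?mulN1r; lra.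
  rewrite sum_cw; last by lia.
  have -> : r.*2.-1%:R = 2 * r%:R - 1 :> R.
    by apply/eqP; rewrite -subr_eq opprK natr1 prednK ?double_gt0 ?(ltnW r2) // -muln2 natrM mulrC.
  have c0 : 0 <= cN by rewrite /cN invr_ge0 !mulr_ge0 //; lra.
  rewrite -/cN mulrBr -[leRHS]subr0; apply: lerB; last by rewrite mulr_ge0.
  rewrite -mulrA invfM mulrA divff // mul1r.
  by rewrite (_ : 2 * r%:R - 1 - 1 = 2 * r%:R - 2 :> R) //; ring.
(* The truncation term is n * cN. Writing n = N - (N - n) with N - n decreasing, summation by parts
   makes its total O(q / N). *)
have T2 : cN * \sum_(1 <= n < N) x n * n%:R <= q%:R / (N%:R - 1).
  have -> : \sum_(1 <= n < N) x n * n%:R =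
    N%:R * \sum_(1 <= n < N) x n - \sum_(1 <= n < N) x n * (N - n)%N%:R.
    rewrite mulr_sumr -sumrB; apply: eq_big_nat => n hn.
    by rewrite natrB; [ring|lia].
  have a1 := oqc_partial 1 N.
  have a2 : `|\sum_(1 <= n < N) x n * (N - n)%N%:R| <= q%:R * (N - 1)%N%:R.
    apply: abel_le => //; last by lia.
      by move=> c; exact: oqc_partial.
    by move=> n _ _; rewrite ler_nat; lia.
  have a3 : (N - 1)%N%:R <= N%:R :> R by rewrite ler_nat; lia.
  have q0 : 0 <= q%:R :> R by rewrite ler0n.
  have -> : q%:R / (N%:R - 1) = cN * (2 * N%:R * q%:R).
    by rewrite /cN; field; rewrite !lt0r_neq0 //; lra.
  apply: ler_wpM2l; first by rewrite /cN invr_ge0 !mulr_ge0 //; lra.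
  move: a1 a2; rewrite !ler_norml => /andP[_ a1] /andP[a2 _]; nra.
(* Past N - 1 every hat k < N is on its descending side, so [phi] decreases and summation by parts
   applies again. *)
have T3 : - \sum_(N <= n < N.*2) x n * phi R r N n <= q%:R * (2 / (N%:R - 1)).
  apply: le_trans (ler_norm _) _; rewrite normrN.
  have dec n : (N.-1 <= n)%N -> phi R r N n.+1 <= phi R r N n.
    move=> hn; rewrite /phi big_nat [leRHS]big_nat; apply: ler_sum => k hk.
    rewrite ler_wpM2l ?cw_ge0 // ler_nat /hat; lia.
  have g0 n : 0 <= phi R r N n.
    by apply: sumr_ge0 => k _; rewrite mulr_ge0 ?cw_ge0 ?ler0n.
  apply: (@le_trans _ _ (q%:R * phi R r N N)).
    apply: abel_le => //; last by lia.
      by move=> c; exact: oqc_partial.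
    by move=> n hn _; apply: dec; lia.
  rewrite ler_wpM2l ?ler0n //.
  (* [phi_tail] stops at n < N, so the value at N is bounded by the value at N - 1. *)
  have hp := dec N.-1 (leqnn _); rewrite prednK in hp; last by lia.
  apply: le_trans hp _.
  have h1 : (r.*2.-1 <= N.-1 < N)%N by lia.
  have /andP[_] := @phi_tail R r N N.-1 r2 h1; rewrite /cw.
  have -> : N.-1%:R = N%:R - 1 :> R by rewrite -[in RHS](@prednK N) ?natr1 ?addrK // -?natr1 ?addrK //; lia.
  move=> h2.
  have hN4 : 5 <= N%:R :> R by rewrite (ler_nat R 5); lia.
  have -> : 2 / (N%:R - 1) = (N%:R - 1)^-1 + (N%:R - 1)^-1 :> R by ring.
  have h3 : 0 <= (N%:R - 1) / (2 * N%:R * (N%:R - 1)) :> R.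
    by rewrite divr_ge0 ?mulr_ge0 //; lra.
  have h4 : 2 * ((N%:R - 1 - 1) * (N%:R - 1) * (N%:R - 1 + 1))^-1 <= (N%:R - 1)^-1 :> R.
    have -> : (N%:R - 1)^-1 = ((N%:R - 2) * N%:R) *
       ((N%:R - 1 - 1) * (N%:R - 1) * (N%:R - 1 + 1))^-1 :> R.
      by field; rewrite !lt0r_neq0 //; lra.
    rewrite ler_wpM2r ?invr_ge0 ?mulr_ge0 //; nra.
  lra.
have S1 : \sum_(1 <= n < N) x n / n%:R =
  \sum_(1 <= n < r.*2.-1) x n / n%:R + \sum_(r.*2.-1 <= n < N) x n / n%:R.
  by rewrite (@big_cat_nat _ _ _ r.*2.-1) //=; lia.
have S2 : \sum_(1 <= n < N) x n * n%:R =
  \sum_(1 <= n < r.*2.-1) x n * n%:R + \sum_(r.*2.-1 <= n < N) x n * n%:R.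
  by rewrite (@big_cat_nat _ _ _ r.*2.-1) //=; lia.
have S3 : \sum_(0 <= n < N.*2) x n * phi R r N n =
  \sum_(1 <= n < r.*2.-1) x n * phi R r N n + \sum_(r.*2.-1 <= n < N) x n * phi R r N n
  + \sum_(N <= n < N.*2) x n * phi R r N n.
  rewrite (@big_cat_nat _ _ _ N) //=; last by lia.
  rewrite (@big_cat_nat _ _ _ r.*2.-1) //=; last by lia.
  rewrite (@big_cat_nat _ _ _ 1) //=; last by lia.
  rewrite big_nat1 [phi R r N 0](_ : _ = 0) ?mulr0 ?add0r //.
  by rewrite /phi big1 // => k _; rewrite /hat min0n mulr0.
have T4 := sum_phi_le r2 (_ : r < N)%N.
rewrite S1 E1 E2; rewrite S2 mulrDr in T2; rewrite S3 in T4.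
have {}T4 := T4 ltac:(lia).
have -> : 4 * q%:R / (N%:R - 1) = q%:R / (N%:R - 1) + q%:R * (2 / (N%:R - 1)) + q%:R / (N%:R - 1) :> R by ring.
have : 0 <= q%:R / (N%:R - 1) :> R by rewrite divr_ge0 ?ler0n //; lra.
lra.
Qed.
End Lbound.

(** * The saving *)

Lemma sum_nat_ge1 (R : realType) (P : pred nat) (F : nat -> R) (N p : nat) :
  (forall i, P i -> 0 <= F i) -> (p < N)%N -> P p ->
  F p <= \sum_(0 <= i < N | P i) F i.
Proof.
move=> F0 pN Pp; rewrite big_mkcond (bigD1_seq p) ?iota_uniq ?mem_index_iota //= Pp.
by rewrite lerDl sumr_ge0 // => i _; case: ifP => // /F0.
Qed.

Lemma sum_bool_le1 (R : realType) (N : nat) (P : pred nat) (b : nat -> bool) :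
  (forall i j, P i -> P j -> b i -> b j -> i = j) ->
  \sum_(0 <= i < N | P i) (b i)%:R <= 1 :> R.
Proof.
move=> inj; case: (pselect (exists i, [/\ (i < N)%N, P i & b i])) => [[i [iN Pi bi]]|nex].
  rewrite big_mkcond (bigD1_seq i) ?iota_uniq ?mem_index_iota //= Pi bi big1 ?addr0 // => j ji.
  by case: ifP => // Pj; case bj: (b j) => //; rewrite (inj _ _ Pj Pi bj bi) eqxx in ji.
rewrite big_nat_cond big1 ?ler01 // => j /andP[/andP[_ jN] Pj].
by case bj: (b j) => //; case: nex; exists j.
Qed.

Lemma sum_multiples (R : realType) (F : nat -> R) (p N : nat) : (0 < p)%N ->
  (forall n, (N <= n)%N -> F n = 0) ->
  \sum_(1 <= n < N) (p %| n)%:R * F n = \sum_(1 <= m < N) F (p * m)%N.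
Proof.
move=> p0 F0.
have E1 m : (1 <= m < N)%N -> F (p * m)%N = \sum_(1 <= n < N) (n == p * m)%N%:R * F n.
  move=> hm; case: (ltnP (p * m) N) => h.
    rewrite (bigD1_seq (p * m)%N) ?iota_uniq ?mem_index_iota //=; last first.
      by rewrite h andbT muln_gt0 p0; case/andP: hm.
    rewrite eqxx mul1r big1 ?addr0 // => n /negPf ->; exact: mul0r.
  rewrite F0 // big_nat big1 // => n hn.
  by rewrite (_ : (n == _)%N = false) ?mul0r //; lia.
rewrite [RHS]big_nat; under [RHS]eq_bigr => m hm do rewrite E1 //.
rewrite -big_nat exchange_big /=; apply: eq_big_nat => n hn.
rewrite -mulr_suml; congr (_ * _).
case: (boolP (p %| n)%N) => [/dvdnP[k nk]|nd].
  have hk : (1 <= k < N)%N by nia.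
  rewrite (bigD1_seq k) ?iota_uniq ?mem_index_iota //= nk mulnC eqxx big1 ?addr0 //.
  by move=> m /negPf mk; rewrite eqn_pmul2l // eq_sym mk.
rewrite big1 // => m _; case: eqP => // e.
by rewrite e dvdn_mulr in nd.
Qed.

Section Savings.
Variables (R : realType) (q : nat) (x : nat -> R).
Hypothesis hx : odd_quad_char q x.

Lemma oqc_d_ge0 n : 0 <= 1 - x n.
Proof. by case: (oqc_val hx n) => ->; lra. Qed.

Lemma oqc_d_le2 n : 1 - x n <= 2.
Proof. by case: (oqc_val hx n) => ->; lra. Qed.

Lemma oqc_good n : (0 < n)%N -> (forall p, prime p -> (p %| n)%N -> x p = 1) -> x n = 1.
Proof.
elim/ltn_ind: n => n IH n0 hp.
case: (ltnP 1 n) => n1; last by rewrite (_ : n = 1%N) ?(oqc_1 hx) //; lia.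
have pp := pdiv_prime n1; have pd := pdiv_dvd n.
rewrite -(divnK pd) (oqc_mul hx) (hp _ pp pd) mulr1; apply: IH.
- by rewrite ltn_Pdiv ?(prime_gt1 pp).
- by rewrite (divn_gt0 _ (prime_gt0 pp)) (dvdn_leq n0 pd).
- by move=> p pp' pn; apply: hp => //; apply: dvdn_trans pn _; exact: dvdn_div.
Qed.

(** One prime divisor p of n with x p <> 1 suffices: x p = 0 forces x n = 0, and x p = -1 already
    gives the largest possible value 2. *)
Lemma oqc_d_le_sum n N : (0 < n < N)%N ->
  1 - x n <= \sum_(0 <= p < N | prime p) (p %| n)%:R * (1 - x p).
Proof.
move=> /andP[n0 nN].
have F0 p : prime p -> 0 <= (p %| n)%:R * (1 - x p) by rewrite mulr_ge0 ?oqc_d_ge0.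
case: (pselect (exists p, [/\ prime p, (p %| n)%N & x p != 1])) => [[p [pp pn xp]]|nex].
  have h := @sum_nat_ge1 R prime (fun p => (p %| n)%:R * (1 - x p)) N p F0 _ pp.
  apply: le_trans (h _); last by rewrite (leq_ltn_trans _ nN) // dvdn_leq.
  rewrite /= pn mul1r; case: (oqc_val hx p) => xpE; rewrite xpE.
  - by case/dvdnP: pn => k ->; rewrite (oqc_mul hx) xpE mulr0.
  - by rewrite xpE eqxx in xp.
  - by rewrite opprK; exact: oqc_d_le2.
rewrite (oqc_good n0) ?subrr; last first.
  by move=> p pp pn; apply/eqP; case: eqP => // /eqP xp; case: nex; exists p.
by apply: sumr_ge0.
Qed.

(** The sum of (1 - x n) * hat rho n is at least rho ^ 2 - sqrt q * rho by [sqsum_le], and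
    subadditivity with [sum_hat_dvdn] bounds it above by rho ^ 2 times the right side. *)
Lemma bad_mass rho : (0 < rho)%N ->
  1 - Num.sqrt q%:R / rho%:R <= \sum_(0 <= p < rho.*2 | prime p) (1 - x p) / p%:R.
Proof.
move=> rho0.
have r0 : 0 < rho%:R :> R by rewrite ltr0n.
have h1 : rho%:R ^+ 2 - Num.sqrt q%:R * rho%:R <=
    \sum_(0 <= n < rho.*2) (1 - x n) * (hat rho n)%:R.
  under eq_bigr do rewrite mulrBl mul1r.
  rewrite sumrB -natr_sum sum_hat1 natrX lerB // -sum_hat.
  by apply: le_trans (ler_norm _) _; exact: sqsum_le.
have h2 : \sum_(0 <= n < rho.*2) (1 - x n) * (hat rho n)%:R <=
   \sum_(0 <= p < rho.*2 | prime p) (1 - x p) / p%:R * rho%:R ^+ 2.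
  apply: (@le_trans _ _ (\sum_(0 <= n < rho.*2)
     (\sum_(0 <= p < rho.*2 | prime p) (p %| n)%:R * (1 - x p)) * (hat rho n)%:R)).
    rewrite big_nat [leRHS]big_nat; apply: ler_sum => n /andP[_ hn].
    case: (posnP n) => [->|n0]; first by rewrite /hat min0n !mulr0.
    by rewrite ler_wpM2r ?ler0n // oqc_d_le_sum // n0.
  under eq_bigr do rewrite mulr_suml.
  rewrite exchange_big /=; apply: ler_sum => p pp.
  have p0 : 0 < p%:R :> R by rewrite ltr0n prime_gt0.
  under eq_bigr do rewrite mulrAC -natrM mulrC.
  rewrite -mulr_sumr -mulrA ler_wpM2l ?oqc_d_ge0 // -natr_sum.
  rewrite mulrC ler_pdivlMr // -natrX -natrM ler_nat mulnC.
  by apply: sum_hat_dvdn; exact: prime_gt0.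
rewrite -mulr_suml in h2.
have := le_trans h1 h2; rewrite -ler_pdivrMr ?exprn_gt0 // => h; apply: le_trans h.
rewrite le_eqVlt; apply/orP; left; apply/eqP; field; exact: lt0r_neq0.
Qed.

Variable r : nat.
Hypothesis r2 : (2 <= r)%N.
Local Notation N := r.*2.-1.
Local Notation w := (wt R r).

Definition saving : R := \sum_(1 <= n < N) w n * (1 - x n).
Definition wsum p : R := \sum_(1 <= m < N) w (p * m)%N.

Lemma wsum_ge0 p : 0 <= wsum p.
Proof. by apply: sumr_ge0 => m _; exact: wt_ge0. Qed.

(** P holds the primes whose multiples are counted, B those removed from cofactors. Two instances
    are used: B = P an initial segment of the bad primes, where [large_pair] and [large_cofactor]
    are vacuous, and P all bad primes with B those up to sqrt (2r). *)
Variables B P : pred nat.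
Hypothesis P_prime : forall p, P p -> prime p.
Hypothesis BP : forall p, B p -> P p.
Definition Bfree m := ~~ has B (primes m).
Hypothesis large_pair : forall p p', P p -> P p' -> ~~ B p -> ~~ B p' -> p != p' ->
  (N <= p * p')%N.
Hypothesis large_cofactor : forall p m, P p -> ~~ B p -> (0 < m)%N -> (p * m < N)%N ->
  Bfree m -> x m = 1.

(* Each n < 2r - 1 has at most one factorization n = p * m with P p and m free
   of primes in B. *)
Lemma saving_split :
  \sum_(0 <= p < N | P p) \sum_(1 <= m < N) (Bfree m)%:R * (w (p * m)%N * (1 - x (p * m)%N))
  <= saving.
Proof.
have -> : \sum_(0 <= p < N | P p) \sum_(1 <= m < N) (Bfree m)%:R * (w (p * m)%N * (1 - x (p * m)%N))
  = \sum_(1 <= n < N) (w n * (1 - x n)) *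
      (\sum_(0 <= p < N | P p) ((p %| n)%N && Bfree (n %/ p))%:R).
  under [RHS]eq_bigr do rewrite mulr_sumr.
  rewrite [RHS]exchange_big /=; apply: eq_bigr => p Pp.
  have p0 := prime_gt0 (P_prime Pp).
  pose F n : R := (Bfree (n %/ p))%:R * (w n * (1 - x n)).
  have F0 n : (N <= n)%N -> F n = 0 by move=> h; rewrite /F wt_out // mul0r mulr0.
  transitivity (\sum_(1 <= m < N) F (p * m)%N).
    by apply: eq_bigr => m _; rewrite /F mulKn.
  rewrite -sum_multiples //; apply: eq_bigr => n _.
  by rewrite /F -mulnb natrM mulrA mulrC.
apply: ler_sum_nat => n hn.
have h0 : 0 <= w n * (1 - x n) by apply: mulr_ge0; [exact: wt_ge0 | exact: oqc_d_ge0].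
rewrite -[leRHS]mulr1 (ler_wpM2l h0) //.
apply: sum_bool_le1 => p p' Pp Pp' /andP[pn fp] /andP[pn' fp'].
apply/eqP; apply: contraT => pp'.
have pr := P_prime Pp; have pr' := P_prime Pp'.
have dv : (p * p' %| n)%N.
  by rewrite Gauss_dvd ?pn ?pn' // prime_coprime // dvdn_prime2.
have nB (a b : nat) : prime a -> prime b -> (a * b %| n)%N -> Bfree (n %/ a) -> ~~ B b.
  move=> pa pb /dvdnP[k nk] /hasPn; apply; rewrite mem_primes pb.
  have -> : (n %/ a = k * b)%N by rewrite nk mulnCA mulKn // prime_gt0.
  rewrite dvdn_mull // andbT; case: (posnP (k * b)) => // h.
  by move: hn; rewrite nk mulnCA h muln0.
have dv' : (p' * p %| n)%N by rewrite mulnC.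
have h := large_pair Pp Pp' (nB _ _ pr' pr dv' fp') (nB _ _ pr pr' dv fp) pp'.
case/andP: hn => n0 nN.
by have := leq_ltn_trans (dvdn_leq n0 dv) nN; rewrite ltnNge h.
Qed.

(** Union bound over B, the simplest lower-bound sieve. *)
Lemma Bfree_ge m : (0 < m < N)%N ->
  1 - \sum_(0 <= b < N | B b) (b %| m)%:R <= (Bfree m)%:R :> R.
Proof.
move=> /andP[m0 mN]; rewrite /Bfree; case: (boolP (has B (primes m))) => [|_]; last first.
  by rewrite gerBl sumr_ge0.
move/hasP => [b]; rewrite mem_primes => /and3P[pb _ bm] Bb.
rewrite subr_le0; have := @sum_nat_ge1 R B (fun b => (b %| m)%:R) N b.
rewrite bm; apply => //.
by apply: leq_ltn_trans mN; exact: dvdn_leq.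
Qed.

(** Summed over n = p * m with m free of B, the pointwise bound 1 - x p * x m >= (1 - x p) * (1 - (1
    - x m) / 2) leaves a main term, handled by the sieve ([U]), and a loss containing 1 - x m. The
    loss is 0 for p outside B, where x m = 1, and for p in B it is at most saving / p by [wt_mul]
    ([V]); this gives the factor multiplying the saving on the right. *)
Theorem saving_ge :
  (1 - \sum_(0 <= p < N | B p) p%:R^-1) *
    (\sum_(0 <= p < N | P p) (1 - x p) * wsum p) <=
  saving * (1 + (\sum_(0 <= p < N | B p) (1 - x p) / p%:R) / 2).
Proof.
set s' := \sum_(0 <= p < N | B p) p%:R^-1.
set s := \sum_(0 <= p < N | B p) _ / _.
have U p : P p -> (1 - s') * wsum p <= \sum_(1 <= m < N) (Bfree m)%:R * w (p * m)%N.
  move=> Pp; have p0 := prime_gt0 (P_prime Pp).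
  apply: (@le_trans _ _ (\sum_(1 <= m < N) (1 - \sum_(0 <= b < N | B b) (b %| m)%:R) * w (p * m)%N)); last first.
    apply: ler_sum_nat => m hm; rewrite ler_wpM2r ?wt_ge0 //.
    by apply: Bfree_ge; move: hm.
  under eq_bigr do rewrite mulrBl mul1r.
  rewrite sumrB mulrBl mul1r lerB // -/(wsum p).
  under eq_bigr do rewrite mulr_suml.
  rewrite exchange_big /= /s' mulr_suml; apply: ler_sum => b Bb.
  have b0 := prime_gt0 (P_prime (BP Bb)).
  rewrite (@sum_multiples R (fun m => w (p * m)%N)) //; last first.
    by move=> n hn; rewrite wt_out // (leq_trans hn) // leq_pmull.
  rewrite /wsum mulr_sumr; apply: ler_sum_nat => m hm.
  by rewrite mulnCA mulrC wt_mul // muln_gt0 p0; case/andP: hm.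
have V p : P p -> \sum_(1 <= m < N) (Bfree m)%:R * (w (p * m)%N * (1 - x m)) <=
    (B p)%:R * (saving / p%:R).
  move=> Pp; have p0 := prime_gt0 (P_prime Pp).
  case: (boolP (B p)) => Bp.
    rewrite mul1r /saving mulr_suml; apply: ler_sum_nat => m /andP[m0 _].
    have -> : w m * (1 - x m) / p%:R = 1 * (w m / p%:R * (1 - x m)) by ring.
    apply: ler_pM => //.
    - by apply: mulr_ge0; [exact: wt_ge0 | exact: oqc_d_ge0].
    - by case: Bfree; rewrite ?ler01.
    by rewrite ler_wpM2r ?oqc_d_ge0 // wt_mul.
  rewrite mul0r big_nat big1 // => m /andP[m0 mN].
  case: (boolP (Bfree m)) => Bm; last by rewrite mul0r.
  case: (ltnP (p * m) N) => h; last by rewrite wt_out // !(mul0r, mulr0).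
  by rewrite (large_cofactor Pp Bp m0 h Bm) subrr !mulr0.
have key : \sum_(0 <= p < N | P p) (1 - x p) * ((1 - s') * wsum p - (B p)%:R * (saving / p%:R) / 2)
    <= saving.
  apply: le_trans saving_split; apply: ler_sum => p Pp.
  apply: (@le_trans _ _ ((1 - x p) * (\sum_(1 <= m < N) (Bfree m)%:R * w (p * m)%N -
     (\sum_(1 <= m < N) (Bfree m)%:R * (w (p * m)%N * (1 - x m))) / 2))).
    rewrite ler_wpM2l ?oqc_d_ge0 // lerB ?U // ler_pM2r ?invr_gt0 //; exact: V.
  rewrite mulr_suml -sumrB mulr_sumr; apply: ler_sum => m _.
  rewrite (oqc_mul hx); case: (Bfree m); last by rewrite !mul0r subrr mulr0.
  rewrite !mul1r; have := wt_ge0 R (p * m) r2; have := oqc_d_ge0 m.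
  move: (w (p * m)%N) => W.
  case: (oqc_val hx p) => ->; case: (oqc_val hx m) => ->; lra.
have e (S : R) (W : nat -> R) : \sum_(0 <= p < N | P p) (1 - x p) * ((1 - s') * W p - (B p)%:R * (S / p%:R) / 2) =
   (1 - s') * (\sum_(0 <= p < N | P p) (1 - x p) * W p) - S * (s / 2).
  have -> : s = \sum_(0 <= p < N | P p) (B p)%:R * ((1 - x p) / p%:R).
    rewrite /s big_mkcond [RHS]big_mkcond; apply: eq_bigr => p _.
    case: (boolP (B p)) => Bp; first by rewrite BP // mul1r.
    by case: ifP; rewrite ?mul0r.
  rewrite mulr_suml !mulr_sumr -sumrB; apply: eq_bigr => p _; ring.
rewrite e in key; rewrite mulrDr mulr1; lra.
Qed.
End Savings.

(** * Numerical bounds *)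

(* (1 + 1/738)^512 and (1 + 1/739)^512 straddle 2, as 512 / ln 2 is 738.66. *)
Lemma ln2_upper_witness : (2 * 738 ^ 512 <= 1 * 739 ^ 512)%N.
Proof. Zify.zify; vm_compute; reflexivity. Qed.

Lemma ln2_lower_witness : (1 * 740 ^ 512 <= 2 * 739 ^ 512)%N.
Proof. Zify.zify; vm_compute; reflexivity. Qed.

(* 3^12 = 531441 is close to 2^19 = 524288. *)
Lemma ln3_upper_witness : (512 * 3 ^ 12 <= 519 * 2 ^ 19)%N.
Proof. Zify.zify; vm_compute; reflexivity. Qed.

Section Logs.
Variable R : realType.

Lemma ln_le_sub1 (y : R) : 0 < y -> ln y <= y - 1.
Proof. by move=> y0; rewrite -{1}[y](subrKC 1) le_ln1Dx // ltrBrDl subrr. Qed.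

Lemma ln_ge_1subV (y : R) : 0 < y -> 1 - y^-1 <= ln y.
Proof.
move=> y0; have := @ln_le_sub1 y^-1; rewrite invr_gt0 y0 lnV ?posrE // => /(_ isT); lra.
Qed.

Lemma ln_sub_le (a b : R) : 0 < a -> 0 < b -> ln b - ln a <= b / a - 1.
Proof. by move=> a0 b0; rewrite -ln_div ?posrE // ln_le_sub1 // divr_gt0. Qed.

Lemma lnn_le (a b : nat) : (0 < a)%N -> (a <= b)%N -> ln (a%:R : R) <= ln b%:R.
Proof.
by move=> a0 ab; rewrite ler_ln ?posrE ?ltr0n ?ler_nat // (leq_trans a0).
Qed.

Lemma lnnM (a b : nat) : (0 < a)%N -> (0 < b)%N ->
  ln ((a * b)%N%:R : R) = ln a%:R + ln b%:R.
Proof. by move=> a0 b0; rewrite natrM lnM ?posrE ?ltr0n. Qed.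

Lemma lnnX (a n : nat) : (0 < a)%N -> ln ((a ^ n)%N%:R : R) = n%:R * ln a%:R.
Proof. by move=> a0; rewrite natrX lnXn ?ltr0n // mulr_natl. Qed.

Lemma ln_ratio_le (a : nat) : (0 < a)%N -> ln (a.+1%:R : R) - ln a%:R <= a%:R^-1.
Proof.
move=> a0; have a0' : 0 < a%:R :> R by rewrite ltr0n.
rewrite -ln_div ?posrE ?ltr0n //.
apply: le_trans (ln_le_sub1 _) _; first by rewrite divr_gt0 ?ltr0n.
by rewrite -natr1 mulrDl mul1r divff ?lt0r_neq0 // addrC addKr.
Qed.

Lemma ln_ratio_ge (a : nat) : (0 < a)%N -> a.+1%:R^-1 <= ln (a.+1%:R : R) - ln a%:R.
Proof.
move=> a0; have a0' : 0 < a%:R :> R by rewrite ltr0n.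
rewrite -ln_div ?posrE ?ltr0n //.
have b0 : 0 < a.+1%:R :> R by rewrite ltr0n.
apply: le_trans (ln_ge_1subV _); last by rewrite divr_gt0 ?ltr0n.
rewrite invf_div le_eqVlt; apply/orP; left; apply/eqP.
have -> : a%:R = a.+1%:R - 1 :> R by rewrite -natr1 addrK.
by field; rewrite lt0r_neq0.
Qed.

Lemma lnnMX_le (c a n d b m : nat) : (0 < c)%N -> (0 < a)%N -> (0 < d)%N -> (0 < b)%N ->
  (c * a ^ n <= d * b ^ m)%N ->
  ln (c%:R : R) + n%:R * ln a%:R <= ln d%:R + m%:R * ln b%:R.
Proof.
move=> c0 a0 d0 b0 h; rewrite -!lnnX // -!lnnM ?expn_gt0 ?a0 ?b0 //.
by apply: lnn_le h; rewrite muln_gt0 c0 expn_gt0 a0.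
Qed.

Lemma ln2_le : ln (2 : R) <= 694 / 1000.
Proof.
have := @lnnMX_le 2 738 512 1 739 512 isT isT isT isT ln2_upper_witness.
have := @ln_ratio_le 738 isT; rewrite ln1; lra.
Qed.

Lemma ln2_ge : 6918 / 10000 <= ln (2 : R).
Proof.
have := @lnnMX_le 1 740 512 2 739 512 isT isT isT isT ln2_lower_witness.
have := @ln_ratio_ge 739 isT; rewrite ln1; lra.
Qed.

Lemma ln3_le : ln (3 : R) <= 11 / 10.
Proof.
have := @lnnMX_le 512 3 12 519 2 19 isT isT isT isT ln3_upper_witness.
have p512 : 0 < 512%:R :> R by rewrite ltr0n.
have p519 : 0 < 519%:R :> R by rewrite ltr0n.
have h2 := ln_sub_le p512 p519.
have := ln2_le; lra.
Qed.

Definition harm n : R := \sum_(1 <= k < n.+1) k%:R^-1.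

Lemma harmS n : harm n.+1 = harm n + n.+1%:R^-1.
Proof. by rewrite /harm big_nat_recr. Qed.

Lemma harm0 : harm 0 = 0. Proof. by rewrite /harm big_geq. Qed.

Lemma harm_ln_dec m n : (0 < m <= n)%N -> harm n - ln n%:R <= harm m - ln m%:R.
Proof.
move=> /andP[m0 mn]; rewrite -(subnKC mn); elim: (n - m)%N => [|d IH]; first by rewrite addn0.
have h := @ln_ratio_ge (m + d)%N ltac:(lia); move: h IH; rewrite addnS harmS.
move: (ln (m + d).+1%:R) (ln (m + d)%:R) ((m + d).+1%:R^-1) => u v t; lra.
Qed.

Lemma harm_ln_inc m n : (0 < m <= n)%N -> harm m - ln m.+1%:R <= harm n - ln n.+1%:R.
Proof.
move=> /andP[m0 mn]; rewrite -(subnKC mn); elim: (n - m)%N => [|d IH]; first by rewrite addn0.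
have h := @ln_ratio_le (m + d).+1 ltac:(lia); move: h IH; rewrite addnS harmS.
move: (ln (m + d).+2%:R) (ln (m + d).+1%:R) ((m + d).+1%:R^-1) => u v t; lra.
Qed.

Lemma harm_le n : (8 <= n)%N -> harm n - ln n%:R <= 643 / 1000.
Proof.
move=> n8; apply: le_trans (@harm_ln_dec 8 n _) _; first by rewrite n8.
have -> : ln (8%:R : R) = 3 * ln 2 by rewrite (_ : 8 = 2 ^ 3)%N // lnnX.
rewrite !harmS harm0; have := ln2_ge; lra.
Qed.

Lemma harm_ge n : (2 <= n)%N -> 4 / 10 <= harm n - ln n.+1%:R.
Proof.
move=> n2; apply: le_trans (@harm_ln_inc 2 n _); last by rewrite n2.
rewrite !harmS harm0; have := ln3_le; lra.
Qed.

Lemma sum_idn n : \sum_(1 <= k < n.+1) k%:R = n%:R * (n%:R + 1) / 2 :> R.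
Proof.
elim: n => [|n IH]; first by rewrite big_geq // !mul0r.
by rewrite big_nat_recr //= IH -natr1; field.
Qed.

(** Asymptotically ln r + gamma + 2 ln 2 - 3/2, with gamma Euler's constant. *)
Lemma sum_wt r : (2 <= r)%N ->
  \sum_(1 <= n < r.*2.-1) wt R r n = 2 * harm r.*2.-2 - harm r - 3 / 2 + 3 / (2 * r%:R).
Proof.
move=> r2; have hr : 2 <= r%:R :> R by exact: natr_ge2.
have E : (r.*2.-1 = r.*2.-2.+1)%N by lia.
pose D : R := 2 * r%:R * (r%:R - 1).
have D0 : D != 0 by rewrite lt0r_neq0 // /D; nra.
have -> : \sum_(1 <= n < r.*2.-1) wt R r n =
   \sum_(1 <= n < r.+1) (n%:R^-1 - n%:R / D) +
   \sum_(r.+1 <= n < r.*2.-1) (2 * n%:R^-1 - (4 * r%:R - 2) / D + n%:R / D).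
  rewrite (@big_cat_nat _ _ _ r.+1) /=; [|lia|lia]; congr (_ + _); apply: eq_big_nat => n hn.
    have n0 : n%:R != 0 :> R by rewrite pnatr_eq0; lia.
    rewrite /wt /eta (_ : (n <= r)%N) -/D; last by lia.
    by field; rewrite n0 D0.
  have n0 : n%:R != 0 :> R by rewrite pnatr_eq0; lia.
  have nr : (n <= r)%N = false by lia.
  have nr2 : (n <= r.*2 - 2)%N by lia.
  rewrite /wt /eta nr nr2.
  have r0 : r%:R != 0 :> R by rewrite lt0r_neq0 //; lra.
  have r1 : r%:R - 1 != 0 :> R by rewrite lt0r_neq0 //; lra.
  by rewrite /D; field; rewrite n0 r0 r1.
rewrite sumrB -mulr_suml -/(harm r) sum_idn.
have S (F : nat -> R) : \sum_(r.+1 <= n < r.*2.-1) F n =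
    \sum_(1 <= n < r.*2.-2.+1) F n - \sum_(1 <= n < r.+1) F n.
  rewrite -E [X in _ = X - _](@big_cat_nat _ _ _ r.+1) /=; [|lia|lia].
  by rewrite addrAC subrr add0r.
rewrite S.
have T m : \sum_(1 <= n < m.+1) (2 * n%:R^-1 - (4 * r%:R - 2) / D + n%:R / D) =
  2 * harm m - m%:R * ((4 * r%:R - 2) / D) + m%:R * (m%:R + 1) / 2 / D.
  rewrite big_split sumrB -!mulr_sumr -mulr_suml sum_idn -/(harm m) /=.
  by rewrite sumr_const_nat subn1 /= -mulr_natl; ring.
rewrite !T.
have -> : r.*2.-2%:R = 2 * r%:R - 2 :> R.
  apply/eqP; rewrite -subr_eq opprK -natrD -natrM; apply/eqP; congr (_%:R); lia.
have r0 : r%:R != 0 :> R by rewrite lt0r_neq0 //; lra.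
have r1 : r%:R - 1 != 0 :> R by rewrite lt0r_neq0 //; lra.
rewrite /D; move: (harm _) (harm _) => h1 h2; field.
by rewrite r0 r1.
Qed.

(** With Y = (r - 1) / p the summand is the lower bound for p * wt r (p * m) coming from [eta_ge]. M
    is the integer part of Y, or 1 if Y < 1. For M >= 2 the constant is 0.4 from [harm_ge] minus 1/4
    from the quadratic terms. *)
Lemma harm_quad_ge (Y : R) : 8 / 10 <= Y -> exists2 M : nat, (0 < M)%N /\ (M%:R <= Y \/ M = 1%N) &
  ln Y + 15 / 100 <= \sum_(1 <= m < M.+1) (m%:R^-1 - m%:R / (2 * Y ^+ 2)).
Proof.
move=> Y8; have Y0 : 0 < Y by lra.
have Y20 : 0 < Y ^+ 2 by rewrite exprn_gt0.
have sumE M : \sum_(1 <= m < M.+1) (m%:R^-1 - m%:R / (2 * Y ^+ 2)) =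
    harm M - M%:R * (M%:R + 1) / (4 * Y ^+ 2) :> R.
  rewrite sumrB -mulr_suml sum_idn -/(harm M); field; exact: lt0r_neq0.
case: (ltrP Y 1) => Y1.
  exists 1%N; first by split => //; right.
  rewrite sumE harmS harm0 add0r invr1.
  have h := ln_le_sub1 Y0.
  have : 1 * (1 + 1) / (4 * Y ^+ 2) <= 79 / 100.
    by rewrite ler_pdivrMr ?mulr_gt0 //; nra.
  lra.
have [M M1 MY] : exists2 M : nat, M%:R <= Y & Y < M.+1%:R.
  by exists (Num.truncn Y); have /andP[] := truncn_itv (ltW Y0).
have M0 : (0 < M)%N by rewrite -(ltr_nat R); rewrite -natr1 in MY; lra.
exists M; first by split => //; left.
rewrite sumE.
have m1 : 1 <= M%:R :> R by rewrite ler1n.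
have L0 : 0 < M%:R + 1 :> R by lra.
have lnY : ln Y <= ln M.+1%:R + Y / (M%:R + 1) - 1.
  have : ln (Y / (M%:R + 1)) <= Y / (M%:R + 1) - 1 by rewrite ln_le_sub1 // divr_gt0.
  rewrite ln_div ?posrE // -(natr1 M); lra.
have key : Y / (M%:R + 1) + M%:R * (M%:R + 1) / (4 * Y ^+ 2) <= 1 + M%:R / (4 * (M%:R + 1)).
  rewrite -natr1 in MY.
  have e : 1 + M%:R / (4 * (M%:R + 1)) - (Y / (M%:R + 1) + M%:R * (M%:R + 1) / (4 * Y ^+ 2)) =
     (M%:R + 1 - Y) * (4 * Y ^+ 2 - M%:R * (M%:R + 1 + Y)) / (4 * (M%:R + 1) * Y ^+ 2).
    by field; rewrite !lt0r_neq0.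
  rewrite -subr_ge0 e; apply: divr_ge0; last by rewrite !mulr_ge0 // ltW.
  apply: mulr_ge0; nra.
case: (ltnP 1 M) => M2.
  have := harm_ge M2.
  have : M%:R / (4 * (M%:R + 1)) <= 1 / 4 :> R by rewrite ler_pdivrMr ?mulr_gt0 //; lra.
  lra.
have eM : M = 1%N by apply/eqP; rewrite eqn_leq M2 M0.
move: key lnY; rewrite eM harmS harm0 invr1.
have -> : 1 + 1 = 2 :> R by lra.
move: (1 * 2 / (4 * Y ^+ 2)) => t; have := ln2_le; lra.
Qed.
End Logs.

Section Numeric.
Variable R : realType.

(** The constant is 0.15 from [harm_quad_ge] minus 0.025 for replacing r - 1 by r. When (r - 1) / p
    < 0.8 the left side is negative. *)
Lemma wsum_ge r p : (100 <= r)%N -> (0 < p)%N ->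
  ln r%:R - ln p%:R + 1 / 8 <= p%:R * wsum R r p.
Proof.
move=> r100 p0; have r2 : (2 <= r)%N by lia.
have pR : 0 < p%:R :> R by rewrite ltr0n.
have rR : 100 <= r%:R :> R by rewrite (ler_nat R 100).
have rpos : 0 < r%:R :> R by lra.
have r1pos : 0 < r%:R - 1 :> R by lra.
have W0 : 0 <= p%:R * wsum R r p by rewrite mulr_ge0 ?ler0n // wsum_ge0.
pose Y : R := (r%:R - 1) / p%:R.
case: (ltrP Y (8 / 10)) => hY.
  apply: le_trans W0.
  have : ln (r%:R / p%:R : R) <= r%:R / p%:R - 1 by apply: ln_le_sub1; rewrite divr_gt0.
  rewrite ln_div ?posrE //.
  have : r%:R / p%:R <= 81 / 100 :> R.
    move: hY; rewrite /Y ltr_pdivrMr // ler_pdivrMr //; lra.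
  lra.
have Y0 : 0 < Y by rewrite divr_gt0.
have [M [M0 MY] hM] := harm_quad_ge hY.
have lnY : ln r%:R <= ln Y + ln p%:R + 25 / 1000.
  have -> : ln Y = ln (r%:R - 1) - ln p%:R by rewrite /Y ln_div ?posrE.
  have : ln (r%:R / (r%:R - 1) : R) <= r%:R / (r%:R - 1) - 1.
    by apply: ln_le_sub1; rewrite divr_gt0.
  rewrite ln_div ?posrE //.
  have : r%:R / (r%:R - 1) <= 1 + 25 / 1000 :> R by rewrite ler_pdivrMr //; lra.
  lra.
have MN : (M < r.*2.-1)%N.
  case: MY => [MY|->]; last by clear -r100; lia.
  have : M%:R < r%:R :> R.
    apply: le_lt_trans MY _; rewrite /Y ltr_pdivrMr //.
    have : 1 <= p%:R :> R by rewrite ler1n.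
    nra.
  by rewrite ltr_nat => h; clear -h r100; lia.
apply: (@le_trans _ _ (\sum_(1 <= m < M.+1) (m%:R^-1 - m%:R / (2 * Y ^+ 2)))); first by lra.
rewrite /wsum [X in _ <= _ * X](@big_cat_nat _ _ _ M.+1) //= mulrDr.
apply: ler_wpDr.
  by rewrite mulr_ge0 ?ler0n // sumr_ge0 // => m _; exact: wt_ge0.
rewrite mulr_sumr; apply: ler_sum_nat => m /andP[m0 _].
have mR : 0 < m%:R :> R by rewrite ltr0n.
have -> : p%:R * wt R r (p * m) = eta R r (p * m) / m%:R.
  by rewrite /wt natrM; field; rewrite !lt0r_neq0.
have -> : m%:R^-1 - m%:R / (2 * Y ^+ 2) = (1 - m%:R ^+ 2 / (2 * Y ^+ 2)) / m%:R.
  by field; rewrite !lt0r_neq0.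
rewrite ler_pM2r ?invr_gt0 //; apply: le_trans (eta_ge R (p * m) r2).
rewrite lerB // natrM /Y.
have -> : m%:R ^+ 2 / (2 * ((r%:R - 1) / p%:R) ^+ 2) = (p%:R * m%:R) ^+ 2 / (2 * (r%:R - 1) ^+ 2) :> R.
  by field; rewrite !lt0r_neq0.
rewrite ler_wpM2l ?sqr_ge0 // lef_pV2 ?posrE ?mulr_gt0 ?exprn_gt0 //.
nra.
Qed.

(** The error term of [mertens] with v = sqrt B, s <= v + 1 and ln A <= ln B = 2 ln v. *)
Lemma mertens_error (v : R) : 1000 * 1000 <= v ->
  (2 * ln v + 1 + (v + 1) * (2 * ln v)) / v ^+ 2 <= 10 / 1000.
Proof.
move=> hv; have v0 : 0 < v by lra.
have s0 : 0 < Num.sqrt v by rewrite sqrtr_gt0.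
have sv : v = Num.sqrt v * Num.sqrt v by rewrite -expr2 sqr_sqrtr // ltW.
have s1 : 1000 <= Num.sqrt v by nra.
have l1 : ln v <= 2 * Num.sqrt v.
  rewrite {1}sv lnM ?posrE //; have := ln_sublinear s0; lra.
rewrite ler_pdivrMr ?exprn_gt0 //.
move: (Num.sqrt v) s0 sv s1 l1 => s s0 sv s1 l1.
apply: (@le_trans _ _ (2 * (2 * s) + 1 + (v + 1) * (2 * (2 * s)))); first by nra.
have h3 : 4 * s * v <= 4 / 1000 * (v * v).
  have : s * 1000 <= v by rewrite sv; nra.
  nra.
have h4 : 8 * s + 1 <= 1 / 1000 * (v * v) by nra.
rewrite expr2; lra.
Qed.

(** [mertens] with A = floor (exp y) and B = 32 r. The constant 1.4 is 1.388 for ln 4, 0.002 for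
    rounding exp y down to A, and 0.01 from [mertens_error]. *)
Lemma prime_tail r (y : R) : 10 ^+ 11 <= r%:R :> R -> 10 <= y -> y <= ln r%:R ->
  \sum_(0 <= p < (32 * r).+1 | prime p && (y < ln p%:R)) ln p%:R / p%:R <=
  ln (32 * r)%N%:R - y + 14 / 10 :> R.
Proof.
move=> hr y10 yr; pose B := (32 * r)%N.
have r0 : 0 < r%:R :> R by apply: lt_le_trans hr; rewrite exprn_gt0.
have e0 := expR_gt0 y.
have eB : expR y <= r%:R by rewrite -[leRHS]lnK ?posrE // ler_expR.
have ey : 1000 <= expR y.
  have -> : y = 10%:R * (y / 10%:R) by field.
  rewrite expRM_natl; apply: le_trans (_ : 2 ^+ 10 <= _); first by lra.
  rewrite lerXn2r ?nnegrE ?expR_ge0 //; have := expR_ge1Dx (y / 10%:R); lra.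
pose A := Num.truncn (expR y).
have /andP[A1 A2] : A%:R <= expR y < A.+1%:R by apply: truncn_itv; exact: ltW.
rewrite -natr1 in A2.
have A0 : 0 < A%:R :> R by lra.
have AB : (0 < A <= B)%N.
  rewrite -(ltr_nat R) A0 -(ler_nat R) /B natrM.
  apply: le_trans A1 _; apply: le_trans eB _; lra.
pose v : R := Num.sqrt B%:R.
have BR : B%:R = 32 * r%:R :> R by rewrite /B natrM.
have B0 : 0 < B%:R :> R by rewrite BR; lra.
have vv : v ^+ 2 = B%:R by rewrite sqr_sqrtr // ltW.
have v0 : 0 < v by rewrite sqrtr_gt0.
have hv : 1000 * 1000 <= v.
  have h32 : 1000 * 1000 * (1000 * 1000) <= v * v.
    rewrite -[v * v]expr2 vv BR; move: hr; rewrite !exprS expr0; lra.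
  rewrite leNgt; apply/negP => h.
  have : v * v < 1000 * 1000 * (1000 * 1000) by apply: ltr_pM => //; exact: ltW.
  by rewrite ltNge h32.
pose s := (Num.truncn v).+1.
have /andP[s1 s2] : (Num.truncn v)%:R <= v < s%:R by apply: truncn_itv; exact: ltW.
have sv : s%:R <= v + 1 by rewrite /s -natr1 lerD2r.
have As : (A <= s ^ 2)%N.
  rewrite -(ler_nat R) natrX; apply: (@le_trans _ _ B%:R).
    by rewrite ler_nat; case/andP: AB.
  by rewrite -vv lerXn2r ?nnegrE ?ler0n ?ltW.
have lnA : y - 2 / 1000 <= ln A%:R.
  have h : 1 - (A%:R / expR y)^-1 <= ln (A%:R / expR y) by apply: ln_ge_1subV; rewrite divr_gt0.
  rewrite ln_div ?posrE // expRK invf_div in h.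
  have : expR y / A%:R <= 1 + 2 / 1000 by rewrite ler_pdivrMr //; lra.
  lra.
have lnA' : ln A%:R <= ln B%:R :> R.
  by rewrite ler_ln ?posrE // ler_nat; case/andP: AB.
have lnB : ln B%:R = 2 * ln v by rewrite -vv lnXn // mulr_natl.
have lnA0 : 0 <= ln (A%:R : R) := ln_nat_ge0 R A.
have M := mertens R AB As.
have ln4 : ln 4 = 2 * ln 2 :> R.
  by rewrite (_ : 4 = 2 * 2 :> R) ?lnM ?posrE //; lra.
have E := mertens_error hv; rewrite vv -lnB in E.
have E2 : (ln B%:R + 1 + s%:R * ln A%:R) / B%:R <= 10 / 1000 :> R.
  apply: le_trans E; rewrite ler_pM2r ?invr_gt0 // lerD2l.
  by apply: ler_pM; rewrite ?ler0n.
apply: (@le_trans _ _ (\sum_(A.+1 <= p < B.+1 | prime p) ln p%:R / p%:R)); last first.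
  have := ln2_le R; rewrite -/B; lra.
rewrite [leRHS](_ : _ = \sum_(0 <= p < B.+1 | prime p && (A < p)%N) ln p%:R / p%:R); last first.
  rewrite [RHS](@big_cat_nat _ _ _ A.+1) //=; last by case/andP: AB.
  rewrite [X in _ = X + _]big_nat_cond [X in _ = X + _]big1 ?add0r.
    rewrite big_nat_cond [RHS]big_nat_cond; apply: eq_bigl => p.
    by case: (prime p); rewrite ?andbF //= andbT; case: (A < p)%N; rewrite ?andbT.
  by move=> p /andP[/andP[_ h1] /andP[_ h2]]; move: h1 h2; rewrite ltnS leqNgt => /negPf ->.
rewrite big_mkcond [leRHS]big_mkcond; apply: ler_sum => p _.
case: (boolP (prime p)) => pp //=.
have p0 : 0 < p%:R :> R by rewrite ltr0n prime_gt0.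
have t0 : 0 <= ln p%:R / p%:R :> R by rewrite divr_ge0 ?ln_nat_ge0 ?ler0n.
case: (ltrP y (ln p%:R)) => yp; last by case: ifP.
rewrite ifT // -(ltr_nat R); apply: le_lt_trans A1 _.
by rewrite -[ltRHS]lnK ?posrE // ltr_expR.
Qed.
End Numeric.

(** * Lower bound for the saving *)

Lemma half_steps (R : realType) (n : nat) (t : R) : t <= n%:R / 2 ->
  2 * t <= \sum_(0 <= j < n) (j%:R / 2 < t)%R%:R.
Proof.
elim: n t => [|n IH] t; first by rewrite mul0r big_geq //; lra.
move=> tn; rewrite big_nat_recr //=.
case: (lerP t (n%:R / 2)) => h.
  by apply: le_trans (IH _ h) _; rewrite lerDl.
have -> : \sum_(0 <= i < n) (i%:R / 2 < t)%R%:R = n%:R :> R.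
  rewrite -[RHS]mulr1 -[n in RHS]subn0 mulr_natl -sumr_const_nat.
  apply: eq_big_nat => i /andP[_ hi]; rewrite (_ : (_ < t)%R) //.
  by apply: le_lt_trans h; rewrite ler_pM2r ?invr_gt0 // ler_nat ltnW.
rewrite -natr1 in tn; rewrite [true%:R](_ : _ = 1) //; lra.
Qed.

(** c * u * G / (1 + u / 2) increases with u, so the numerical check at the lower end u = t is
    enough. *)
Lemma saving_dichotomy_small (R : realType) (c t s' u D G : R) :
  s' <= 1 - c -> t <= u -> 0 <= t -> 0 <= c -> 1307 / 100 <= G -> 0 <= D ->
  154 / 100 * (1 + t / 2) <= c * t * (1307 / 100) ->
  (s' <= 1 -> (1 - s') * (u * G) <= D * (1 + u / 2)) -> 154 / 100 <= D.
Proof.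
move=> hc ht t0 c0 hG D0 hn main.
have h := main ltac:(lra).
have u0 : 0 <= u by lra.
have h1 : c * (u * (1307 / 100)) <= D * (1 + u / 2).
  have k1 : c <= 1 - s' by lra.
  have k2 : 0 <= u * (1307 / 100) by apply: mulr_ge0; [exact: u0 | lra].
  exact: le_trans (ler_pM c0 k2 k1 (ler_wpM2l u0 hG)) h.
rewrite leNgt; apply/negP => hD.
have h2 : 77 / 100 <= c * (1307 / 100).
  case: (ltrP 0 t) => [tp|tn]; last by have e : t = 0 by [lra]; rewrite e in hn; lra.
  by rewrite -(ler_pM2r tp); nra.
nra.
Qed.

(** The final comparison is a concave quadratic in u against a linear function, with room at both u
    = 0 and u = 0.245. *)
Lemma saving_dichotomy_large (R : realType) (s' u D G S : R) :
  0 <= u -> u < 245 / 1000 -> s' <= u -> 1307 / 100 <= G ->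
  6 * (15 / 16) - 2 * (191 / 100) + (G - 6) * u <= S ->
  (1 - s') * S <= D * (1 + u / 2) -> 154 / 100 <= D.
Proof.
move=> u0 hu s'u hG hS key.
have : (1 - u) * (6 * (15 / 16) - 2 * (191 / 100) + (1307 / 100 - 6) * u) <= D * (1 + u / 2).
  apply: le_trans key; apply: ler_pM; [lra|nra|lra|].
  apply: le_trans hS; nra.
move=> h; rewrite leNgt; apply/negP => hD; nra.
Qed.

Section Main.
Variables (R : realType) (q : nat) (x : nat -> R).
Hypothesis hx : odd_quad_char q x.
Variable r : nat.
Hypothesis hr : 10 ^+ 11 <= r%:R :> R.
Hypothesis hl : 266 / 10 <= ln r%:R :> R.
Hypothesis hq : Num.sqrt q%:R <= r%:R :> R.
Local Notation N := r.*2.-1.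

Let rR : 1000 <= r%:R :> R.
Proof. by apply: le_trans hr; rewrite !exprS expr0; lra. Qed.

Let r1000 : (1000 <= r)%N. Proof. by rewrite -(ler_nat R). Qed.
Let r2 : (2 <= r)%N. Proof. by apply: leq_trans r1000. Qed.
Let r100 : (100 <= r)%N. Proof. by apply: leq_trans r1000. Qed.

Definition bad p := prime p && (x p != 1).

Lemma bad_prime p : bad p -> prime p. Proof. by case/andP. Qed.

Lemma bad_d p : bad p -> 1 <= 1 - x p.
Proof. by case/andP => _; case: (oqc_val hx p) => ->; rewrite ?eqxx //; lra. Qed.

Lemma bad_sum_inv (B : pred nat) M : (forall p, B p -> bad p) ->
  \sum_(0 <= p < M | B p) p%:R^-1 <= \sum_(0 <= p < M | B p) (1 - x p) / p%:R.
Proof.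
move=> Bb; apply: ler_sum => p /Bb/bad_d h; rewrite -[leLHS]mul1r.
by rewrite ler_wpM2r ?invr_ge0.
Qed.

Lemma small_saving (B : pred nat) (G : R) : (forall p, B p -> bad p) ->
  (forall p, B p -> G <= ln r%:R - ln p%:R + 1 / 8) ->
  \sum_(0 <= p < N | B p) p%:R^-1 <= 1 :> R ->
  (1 - \sum_(0 <= p < N | B p) p%:R^-1) *
    ((\sum_(0 <= p < N | B p) (1 - x p) / p%:R) * G) <=
  saving x r * (1 + (\sum_(0 <= p < N | B p) (1 - x p) / p%:R) / 2).
Proof.
move=> Bb BG s1.
have Bp p : B p -> prime p by move=> /Bb/bad_prime.
apply: le_trans (@saving_ge R q x hx r r2 B B Bp (fun p h => h) _ _).
- rewrite ler_wpM2l ?subr_ge0 // mulr_suml; apply: ler_sum => p Bpp.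
  have p0 := prime_gt0 (Bp _ Bpp); have pR : 0 < p%:R :> R by rewrite ltr0n.
  rewrite -mulrA ler_wpM2l ?(oqc_d_ge0 hx) // mulrC ler_pdivrMr // mulrC.
  by apply: le_trans (wsum_ge R r100 p0); exact: BG.
- by move=> p p' h _ /negP; rewrite h.
- by move=> p m h /negP; rewrite h.
Qed.

Lemma exists_sqrt2r : exists2 z : nat, (z ^ 2 <= r.*2)%N & (r.*2 < z.+1 ^ 2)%N.
Proof.
pose v : R := Num.sqrt r.*2%:R.
have v0 : 0 <= v by rewrite sqrtr_ge0.
have vv : v ^+ 2 = r.*2%:R by rewrite sqr_sqrtr // ler0n.
have /andP[h1 h2] := truncn_itv v0.
exists (Num.truncn v).
  by rewrite -(ler_nat R) natrX -vv lerXn2r ?nnegrE ?ler0n.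
by rewrite -(ltr_nat R) natrX -vv ltrXn2r ?nnegrE ?ler0n.
Qed.

(** With b = ln r - 47/8, the quantity 6 - cut b (ln p) is the gain ln (r/p) + 1/8 of [wsum_ge]
    clipped to [0, 6]. *)
Definition cut (b L : R) : R := Num.min 6 (Num.max 0 (L - b)).

Lemma cut_ge0 (b L : R) : 0 <= cut b L.
Proof. by rewrite /cut le_min le_max lexx andbT. Qed.

Lemma cut_ge (b L : R) : Num.min 6 (L - b) <= cut b L.
Proof. by rewrite /cut le_min !ge_min !le_max !lexx !orbT. Qed.

(* Tangent line at L = b + d to the concave function L |-> 1 - b / L, then a
   majorization by steps of width 1/2, so that only tails of the prime sum
   are needed. *)
Lemma cut_le (b d L : R) : 0 < b -> 0 < d -> 0 <= L ->
  cut b L <= L * (d ^+ 2 / (b + d) ^+ 2 * (b < L)%R%:R +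
     b / (b + d) ^+ 2 * (\sum_(0 <= j < 12) (b + j%:R / 2 < L)%R%:R) / 2).
Proof.
move=> b0 d0 L0.
have s0 : 0 < (b + d) ^+ 2 by rewrite exprn_gt0 // addr_gt0.
have tangent (M : R) : M - b <= M * (d ^+ 2 / (b + d) ^+ 2 + b / (b + d) ^+ 2 * (M - b)).
  rewrite -subr_ge0.
  have -> : M * (d ^+ 2 / (b + d) ^+ 2 + b / (b + d) ^+ 2 * (M - b)) - (M - b) =
     b * (M - (b + d)) ^+ 2 / (b + d) ^+ 2 by field; rewrite lt0r_neq0 // addr_gt0.
  apply: divr_ge0; last exact: ltW.
  by apply: mulr_ge0; [exact: ltW | exact: sqr_ge0].
have a0 : 0 <= d ^+ 2 / (b + d) ^+ 2 by rewrite divr_ge0 ?sqr_ge0.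
have be0 : 0 <= b / (b + d) ^+ 2 by rewrite divr_ge0 ?sqr_ge0 // ltW.
have c0 : 0 <= \sum_(0 <= j < 12) (b + j%:R / 2 < L)%R%:R :> R by apply: sumr_ge0.
case: (ltrP b L) => bL; last first.
  apply: (@le_trans _ _ 0).
    by rewrite /cut (max_l (_ : L - b <= 0)) ?ge_min ?lexx ?orbT // subr_le0.
  by rewrite mulr0 add0r mulr_ge0 // divr_ge0 // mulr_ge0.
have eqc : \sum_(0 <= j < 12) (b + j%:R / 2 < L)%R%:R =
   \sum_(0 <= j < 12) (j%:R / 2 < L - b)%R%:R :> R.
  by apply: eq_bigr => j _; rewrite ltrBrDl.
rewrite [true%:R](_ : _ = 1) // mulr1.
move: (tangent L) (tangent (b + 6)) c0; rewrite eqc.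
move: (d ^+ 2 / (b + d) ^+ 2) (b / (b + d) ^+ 2) a0 be0 => a be a0 be0 tL t6 c0.
case: (lerP (L - b) 6) => L6.
  have hs := @half_steps R 12 (L - b); move: (hs ltac:(lra)) c0.
  move: (\sum_(0 <= j < 12) _) => c hc c0.
  apply: (@le_trans _ _ (L - b)).
    by rewrite /cut max_r ?ge_min ?lexx ?orbT // subr_ge0 ltW.
  apply: le_trans tL _; rewrite ler_wpM2l // lerD2l -mulrA ler_wpM2l //; lra.
have hs := @half_steps R 12 6; move: (hs ltac:(lra)) => {}hs.
have hc : \sum_(0 <= j < 12) (j%:R / 2 < 6 :> R)%R%:R <= \sum_(0 <= j < 12) (j%:R / 2 < L - b)%R%:R :> R.
  apply: ler_sum => j _; case: (ltrP (j%:R / 2) 6) => h //.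
  by rewrite (lt_trans h L6).
move: hc c0 hs; move: (\sum_(0 <= j < 12) (j%:R / 2 < L - b)%R%:R) (\sum_(0 <= j < 12) _) => c c' hc c0 hs.
apply: (@le_trans _ _ 6); first by rewrite /cut ge_min lexx.
have t6' : 6 <= (b + 6) * (a + be * 6) by lra.
apply: le_trans t6' _; apply: ler_pM; [lra|nra|lra|].
by rewrite lerD2l -mulrA ler_wpM2l //; lra.
Qed.

Definition ptail (y : R) : R :=
  \sum_(0 <= p < 32 * r | prime p) (y < ln p%:R)%R%:R * (ln p%:R / p%:R).

Lemma ptail_le y : 10 <= y -> y <= ln r%:R ->
  ptail y <= 5 * ln 2 + ln r%:R - y + 14 / 10.
Proof.
move=> y10 yr.
have e : ln ((32 * r)%N%:R : R) = 5 * ln 2 + ln r%:R.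
  rewrite lnnM //; last by lia.
  by rewrite (_ : 32 = 2 ^ 5)%N // lnnX.
have := prime_tail hr y10 yr; rewrite e; apply: le_trans.
rewrite /ptail big_mkcond [leRHS]big_mkcond big_nat_recr //=.
have t0 p : 0 <= ln p%:R / p%:R :> R by rewrite divr_ge0 ?ln_nat_ge0 ?ler0n.
apply: ler_wpDr; first by case: ifP.
apply: ler_sum => p _; case: (prime p) => //=.
by case: (y < ln p%:R); rewrite ?mul1r ?mul0r.
Qed.

Let b : R := ln r%:R - 47 / 8.

Lemma cut_cost :
  \sum_(0 <= p < 32 * r | prime p) cut b (ln p%:R) / p%:R <= 191 / 100.
Proof.
have hl' : 266 / 10 <= ln r%:R :> R by exact: hl.
have rR' : 1000 <= r%:R :> R by exact: rR.
have hb : 829 / 40 <= b by rewrite /b; lra.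
have b0 : 0 < b by lra.
(* Any d > 0 is admissible; 4.5 places the point of tangency inside the window of length 6 and
   brings the final quotient below 1.91 at the least value b = 20.725. *)
pose d : R := 45 / 10.
have d0 : 0 < d by rewrite /d; lra.
pose al : R := d ^+ 2 / (b + d) ^+ 2; pose be : R := b / (b + d) ^+ 2.
have s0 : 0 < (b + d) ^+ 2 by rewrite exprn_gt0 // addr_gt0.
have al0 : 0 <= al by rewrite divr_ge0 ?sqr_ge0.
have be0 : 0 <= be by rewrite divr_ge0 ?sqr_ge0 // ltW.
apply: (@le_trans _ _ (al * ptail b + be / 2 * (\sum_(0 <= j < 12) ptail (b + j%:R / 2)))).
  rewrite /ptail exchange_big /= !mulr_sumr -big_split /=; apply: ler_sum => p pp.
  have p0 : 0 < p%:R :> R by rewrite ltr0n prime_gt0.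
  rewrite -mulr_suml ler_pdivrMr //.
  apply: le_trans (cut_le b0 d0 (ln_nat_ge0 R p)) _; rewrite -/al -/be.
  rewrite le_eqVlt; apply/orP; left; apply/eqP.
  move: (\sum_(0 <= j < 12) _) (_ < _)%R%:R => c c'; field; exact: lt0r_neq0.
(* 10.745 = 5 * 0.694 + 47/8 + 1.4, the bound of [ptail_le] at y = b. *)
pose X : R := 2149 / 200.
have lX y : b <= y -> y <= ln r%:R -> ptail y <= X - (y - b).
  move=> h1 h2; have h10 : 10 <= y by lra.
  have := ptail_le h10 h2; have := ln2_le R; rewrite /X /b; lra.
have S : \sum_(0 <= j < 12) ptail (b + j%:R / 2) <= 12 * X - 33.
  apply: (@le_trans _ _ (\sum_(0 <= j < 12) (X - j%:R / 2))).
    apply: ler_sum_nat => j /andP[_ hj].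
    have j0 : 0 <= j%:R :> R by rewrite ler0n.
    have j11 : j%:R <= 11 :> R by rewrite (ler_nat R _ 11).
    have := @lX (b + j%:R / 2); rewrite /b => h.
    have : b + j%:R / 2 - b = j%:R / 2 by ring.
    move=> e; rewrite -/b e in h; apply: h; rewrite /b; lra.
  by rewrite !big_nat_recr //= big_geq //; lra.
have T0 : ptail b <= X by rewrite -[X]subr0 -(subrr b); apply: lX => //; rewrite /b; lra.
apply: (@le_trans _ _ (al * X + be / 2 * (12 * X - 33))).
  by apply: lerD; rewrite ler_wpM2l // divr_ge0.
have -> : al * X + be / 2 * (12 * X - 33) = (d ^+ 2 * X + b * (6 * X - 165 / 10)) / (b + d) ^+ 2.
  by rewrite /al /be; field; rewrite lt0r_neq0 // addr_gt0.
rewrite ler_pdivrMr // /X /d; nra.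
Qed.

(** A larger radius would bring the mass closer to 1 but would lengthen the prime range, whose
    excess ln 32 over ln r enters [cut_cost]. *)
Lemma bad_mass16 : 15 / 16 <= \sum_(0 <= p < 32 * r | prime p) (1 - x p) / p%:R.
Proof.
have rR' : 1000 <= r%:R :> R by exact: rR.
have hq' : Num.sqrt q%:R <= r%:R :> R by exact: hq.
have h := bad_mass hx (_ : 0 < 16 * r)%N.
have -> : (32 * r = (16 * r).*2)%N by lia.
apply: le_trans (h _); last by lia.
have r0 : 0 < r%:R :> R by lra.
have : Num.sqrt q%:R / (16 * r)%N%:R <= 1 / 16 :> R.
  rewrite natrM ler_pdivrMr ?mulr_gt0 //; lra.
lra.
Qed.

Theorem saving_large : 154 / 100 <= saving x r.
Proof.
have hl' : 266 / 10 <= ln r%:R :> R by exact: hl.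
have rR' : 1000 <= r%:R :> R by exact: rR.
have [z z1 z2] := exists_sqrt2r.
have z0 : (0 < z)%N by case: (posnP z) z2 => // ->; lia.
have lz : 2 * ln z%:R <= ln 2 + ln r%:R :> R.
  rewrite -[ln 2 + _]lnM ?posrE //; last by lra.
  rewrite -[2 * _](_ : ln ((z ^ 2)%N%:R : R) = _); last by rewrite lnnX.
  by rewrite -natrM mul2n; apply: lnn_le => //; rewrite expn_gt0 z0.
have l2 := ln2_le R.
pose Gz : R := ln r%:R - ln z%:R + 1 / 8.
(* As z <= sqrt (2r), Gz >= (ln r - ln 2) / 2 + 1/8 >= (26.6 - 0.694) / 2 + 0.125. *)
have hG : 1307 / 100 <= Gz by rewrite /Gz; lra.
pose B p := bad p && (p <= z)%N.
have Bbad p : B p -> bad p by case/andP.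
have BG p : B p -> Gz <= ln r%:R - ln p%:R + 1 / 8.
  case/andP => bp pz; rewrite /Gz lerD2r lerB //.
  by apply: lnn_le => //; rewrite prime_gt0 // bad_prime.
pose sg y : R := \sum_(0 <= p < N | B p && (p <= y)%N) (1 - x p) / p%:R.
have sg0 y : 0 <= sg y.
  by apply: sumr_ge0 => p _; rewrite divr_ge0 ?ler0n // (oqc_d_ge0 hx).
have sgz : sg z = \sum_(0 <= p < N | B p) (1 - x p) / p%:R.
  by apply: eq_bigl => p; rewrite /B -andbA andbb.
have D0 : 0 <= saving x r.
  by apply: sumr_ge0 => n _; rewrite mulr_ge0 ?wt_ge0 ?(oqc_d_ge0 hx).
case: (lerP (245 / 1000) (sg z)) => hs.
  have ex : exists y, 245 / 1000 <= sg y by exists z.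
  (* Stopping at the least such y makes y itself a bad prime and keeps the sieve density s' below
     1/y + 0.245. *)
  case: (ex_minnP ex) => y hy miny.
  have y0 : (0 < y)%N.
    rewrite lt0n; apply/eqP => y0; move: hy; rewrite y0 /sg big1; first by lra.
    by move=> p /andP[/Bbad/bad_prime/prime_gt0 p0]; rewrite leqNgt p0.
  have sgy : sg y.-1 < 245 / 1000.
    case: (ltrP (sg y.-1) (245 / 1000)) => // h.
    by have := miny _ h; rewrite leqNgt ltn_predL y0.
  have By : B y && (y < N)%N.
    apply: contraT => nB; move: hy; rewrite leNgt => /negP []; apply: le_lt_trans sgy.
    rewrite /sg big_nat_cond [leRHS]big_nat_cond.
    rewrite le_eqVlt; apply/orP; left; apply/eqP; apply: eq_bigl => p.
    case: (eqVneq p y) => [->|py].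
      rewrite leqnn; move: nB; rewrite negb_and; case: (B y) => //= h; rewrite ?andbF //.
      by rewrite (negPf h).
    by congr (_ && (_ && _)); clear -y0 py; lia.
  case/andP: By => By yN.
  have split_y (F : nat -> R) : \sum_(0 <= p < N | B p && (p <= y)%N) F p =
      F y + \sum_(0 <= p < N | B p && (p <= y.-1)%N) F p.
    rewrite big_mkcond (bigD1_seq y) ?iota_uniq ?mem_index_iota //= By leqnn /=; congr (_ + _).
    rewrite [RHS]big_mkcond (bigD1_seq y) ?iota_uniq ?mem_index_iota //=.
    rewrite [(y <= y.-1)%N](_ : _ = false) ?andbF ?add0r; last by clear -y0; lia.
    by apply: eq_bigr => p py; congr (if _ && _ then _ else _); clear -y0 py; lia.
  have py := bad_prime (Bbad _ By).
  have yR : 0 < y%:R :> R by rewrite ltr0n.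
  pose s' : R := \sum_(0 <= p < N | B p && (p <= y)%N) p%:R^-1.
  have s'le : s' <= y%:R^-1 + sg y.-1.
    by rewrite /s' split_y lerD2l; apply: bad_sum_inv => p /andP[/Bbad].
  have syge : y%:R^-1 <= sg y.
    rewrite /sg split_y -[leLHS]mul1r; apply: ler_wpDr; first exact: (sg0 y.-1).
    by rewrite ler_wpM2r ?invr_ge0 // bad_d // Bbad.
  have main : s' <= 1 -> (1 - s') * (sg y * Gz) <= saving x r * (1 + sg y / 2).
    move=> s1; apply: small_saving => //.
      by move=> p /andP[/Bbad].
    by move=> p /andP[/BG].
  have fin (c t : R) : s' <= 1 - c -> t <= sg y -> 0 <= t -> 0 <= c ->
      154 / 100 * (1 + t / 2) <= c * t * (1307 / 100) -> 154 / 100 <= saving x r.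
    by move=> h1 h2 h3 h4 h5; exact: (saving_dichotomy_small h1 h2 h3 h4 hG D0 h5 main).
  (* c is a lower bound for 1 - s', and t one for the mass. For y = 2 nothing precedes y, so c = t =
     1/2. For y = 3, c = 0.42 < 1 - 1/3 - 0.245 and t = 1/3. For y >= 5, c = 1 - 1/5 - 0.245 and t =
     0.245. *)
  case: (leqP y 2) => y2.
    have ey : y = 2%N by have := prime_gt1 py; clear -y2; lia.
    have e1 : sg y.-1 = 0.
      rewrite /sg big1 // => p /andP[/Bbad/bad_prime/prime_gt1 p1]; rewrite ey => h; clear -p1 h; lia.
    by apply: (fin (1 / 2) (1 / 2)); move: s'le syge; rewrite e1 ey; clear -hx hr hl hq rR r1000 r2 r100 b; lra.
  case: (leqP y 3) => y3.
    have ey : y = 3%N by clear -y2 y3; lia.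
    by apply: (fin (42 / 100) (1 / 3)); move: s'le syge sgy; rewrite ey; clear -hx hr hl hq rR r1000 r2 r100 b; lra.
  have y5 : (5 <= y)%N.
    by case: (ltnP 4 y) => // y4; have e4 : y = 4%N; [clear -y3 y4; lia | rewrite e4 in py].
  have : y%:R^-1 <= 5^-1 :> R by rewrite lef_pV2 ?posrE // (ler_nat R 5).
  by move=> h5; apply: (fin (555 / 1000) (245 / 1000)); move: s'le sgy hy h5; clear -hx hr hl hq rR r1000 r2 r100 b; lra.
(* Now the mass up to z is below 0.245 and all bad primes are used. As (z + 1) ^ 2 > 2r, two primes
   above z do not both divide an n < 2r - 1; and a cofactor of a prime above z is at most z, so
   being free of B it has no bad prime divisor at all. *)
have Pp p : bad p -> prime p by exact: bad_prime.
have big2 p : (z < p)%N -> forall p', (z < p')%N -> (N <= p * p')%N.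
  move=> hp p' hp'; have : (z.+1 * z.+1 <= p * p')%N by apply: leq_mul.
  by move: z2; rewrite expnS expn1; clear; lia.
have lp p p' : bad p -> bad p' -> ~~ B p -> ~~ B p' -> p != p' -> (N <= p * p')%N.
  by move=> hp hp'; rewrite /B hp hp' /= -!ltnNge => h h' _; exact: big2.
have lc p m : bad p -> ~~ B p -> (0 < m)%N -> (p * m < N)%N -> Bfree B m -> x m = 1.
  move=> hp; rewrite /B hp /= -ltnNge => zp m0 pm fm; apply: (oqc_good hx m0) => p' pp' pm'.
  apply/eqP; apply: contraT => xp'; move/hasPn: fm => /(_ p').
  rewrite mem_primes pp' m0 pm' => /(_ isT).
  rewrite /B /bad pp' xp' /= -ltnNge => zp'.
  have : (z < m)%N by apply: leq_trans zp' _; exact: dvdn_leq.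
  by move=> zm; have := big2 _ zp _ zm; clear -pm; lia.
have key := @saving_ge R q x hx r r2 B bad Pp Bbad lp lc.
rewrite -sgz in key.
set s' := \sum_(0 <= p < N | B p) p%:R^-1 in key.
have s's : s' <= sg z by rewrite sgz; exact: bad_sum_inv.
have lb : 6 * (15 / 16) - 2 * (191 / 100) + (Gz - 6) * sg z <=
    \sum_(0 <= p < N | bad p) (1 - x p) * wsum R r p.
  have N32 : (N <= 32 * r)%N by clear; lia.
  have ext (Q : pred nat) (F : nat -> R) : (forall p, (N <= p)%N -> Q p -> F p = 0) ->
      \sum_(0 <= p < N | Q p) F p = \sum_(0 <= p < 32 * r | Q p) F p.
    move=> F0; rewrite [RHS](@big_cat_nat _ _ _ N) //= [X in _ = _ + X]big_nat_cond.
    by rewrite [X in _ = _ + X]big1 ?addr0 // => p /andP[/andP[h _] Qp]; exact: F0.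
  have -> : \sum_(0 <= p < N | bad p) (1 - x p) * wsum R r p =
     \sum_(0 <= p < 32 * r | prime p) (1 - x p) * wsum R r p.
    rewrite ext; last first.
      move=> p pN _; rewrite /wsum big_nat big1 ?mulr0 // => m /andP[m0 _].
      by rewrite wt_out // (leq_trans pN) // leq_pmulr.
    rewrite big_mkcond [RHS]big_mkcond; apply: eq_bigr => p _; rewrite /bad.
    by case: (prime p) => //=; case: (eqVneq (x p) 1) => [->|]; rewrite ?subrr ?mul0r.
  have -> : sg z = \sum_(0 <= p < 32 * r | prime p) (p <= z)%N%:R * ((1 - x p) / p%:R).
    rewrite sgz ext; last first.
      move=> p pN /andP[bp pz].
      have : (p * 2 <= p * p)%N by rewrite leq_pmul2l ?prime_gt1 ?prime_gt0 ?Pp.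
      have : (p * p <= z ^ 2)%N by rewrite expnS expn1 leq_mul.
      by move=> h1 h2; clear -h1 h2 pN z1 r1000; lia.
    rewrite big_mkcond [RHS]big_mkcond; apply: eq_bigr => p _; rewrite /B /bad.
    case: (prime p) => //=; case: (eqVneq (x p) 1) => [->|] /=; first by rewrite subrr mul0r mulr0.
    by case: (p <= z)%N; rewrite ?mul1r ?mul0r.
  (* Each bad prime is credited 6 - cut, and those up to z are credited Gz - 6 more. *)
  apply: (@le_trans _ _ (\sum_(0 <= p < 32 * r | prime p)
     ((1 - x p) / p%:R * 6 - (1 - x p) / p%:R * cut b (ln p%:R) +
       (Gz - 6) * ((p <= z)%N%:R * ((1 - x p) / p%:R))))).
    rewrite big_split sumrB /= -mulr_sumr -mulr_suml; apply: lerD => //; apply: lerB.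
      by rewrite mulrC ler_pM2r //; exact: bad_mass16.
    apply: (@le_trans _ _ (2 * \sum_(0 <= p < 32 * r | prime p) cut b (ln p%:R) / p%:R)).
      rewrite mulr_sumr; apply: ler_sum => p pp.
      have -> : (1 - x p) / p%:R * cut b (ln p%:R) = (1 - x p) * (cut b (ln p%:R) / p%:R) by ring.
      by rewrite ler_wpM2r ?(oqc_d_le2 hx) // divr_ge0 ?ler0n // cut_ge0.
    by rewrite ler_pM2l //; exact: cut_cost.
  apply: ler_sum => p pp.
  have p0 : 0 < p%:R :> R by rewrite ltr0n prime_gt0.
  have W := wsum_ge R r100 (prime_gt0 pp).
  have W0 : 0 <= p%:R * wsum R r p by rewrite mulr_ge0 ?ler0n // wsum_ge0.
  have -> : (1 - x p) / p%:R * 6 - (1 - x p) / p%:R * cut b (ln p%:R) +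
       (Gz - 6) * ((p <= z)%N%:R * ((1 - x p) / p%:R)) =
     (1 - x p) * ((6 - cut b (ln p%:R) + (Gz - 6) * (p <= z)%N%:R) / p%:R) by ring.
  rewrite ler_wpM2l ?(oqc_d_ge0 hx) // ler_pdivrMr // [leRHS]mulrC.
  have cge := cut_ge b (ln p%:R).
  case: (leqP p z) => pz.
    rewrite mulr1; apply: le_trans W.
    have h1 : ln p%:R <= ln z%:R :> R by apply: lnn_le => //; exact: prime_gt0.
    have h2 : 0 <= cut b (ln p%:R) by exact: cut_ge0.
    by move: h1 h2; rewrite /Gz; clear -hx hr hl hq rR r1000 r2 r100 b; lra.
  rewrite mulr0 addr0; move: cge; rewrite ge_min => /orP[h|h].
    by move: h W0; clear -hx hr hl hq rR r1000 r2 r100 b; lra.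
  by apply: le_trans W; move: h; rewrite /b; clear -hx hr hl hq rR r1000 r2 r100 b; lra.
exact: (saving_dichotomy_large (sg0 z) hs s's hG lb key).
Qed.
End Main.

(** * Conclusion *)

(** Yields ln q >= 77 ln 2 > 53.2, hence the bound ln r >= 26.6. *)
Lemma pow2_77 : (2 ^ 77 <= 2 * 10 ^ 23)%N.
Proof. Zify.zify; vm_compute; reflexivity. Qed.

Section Limit.
Variables (R : realType) (q : nat) (x : nat -> R).
Hypothesis hx : odd_quad_char q x.

Definition lterm (k : nat) : R := x k.+1 / k.+1%:R.

Lemma series_lterm n : series lterm n = \sum_(1 <= k < n.+1) x k / k%:R.
Proof. by rewrite /series /= big_add1. Qed.

Lemma lterm_tail a c : `|\sum_(a <= k < c) lterm k| <= q%:R / a.+1%:R.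
Proof.
case: (leqP c a) => ac.
  by rewrite big_geq // normr0 divr_ge0 ?ler0n.
apply: (@abel_le R (fun k => x k.+1) (fun k => k.+1%:R^-1)) => //.
- by move=> d; rewrite -(big_add1 _ _ a d.+1 predT x); exact: oqc_partial.
- by move=> n _ _; rewrite lef_pV2 ?posrE ?ltr0n // ler_nat.
Qed.

Lemma cvg_lterm : cvgn (series lterm).
Proof.
apply/cauchy_cvgP/cauchy_seriesP => e e0.
have [M hM] : exists M : nat, q%:R / e < M%:R :> R.
  exists (Num.truncn (q%:R / e)).+1.
  have h : 0 <= q%:R / e by rewrite divr_ge0 // ltW.
  by have /andP[] := truncn_itv h.
exists ([set n : nat | (M <= n)%N], [set: nat])%classic; first by split; [exists M|exact: filterT].
move=> [a c] [/= Ma _]; apply: le_lt_trans (lterm_tail a c) _.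
rewrite ltr_pdivrMr ?ltr0n // mulrC -ltr_pdivrMr //.
by apply: lt_le_trans hM _; rewrite ler_nat leqW.
Qed.

(** The strict gap between U and V absorbs the truncation error 4 q / (n - 1). *)
Lemma limn_lterm_le (U V : R) : U < V ->
  (forall n, (q.*2 < n)%N -> \sum_(1 <= k < n) x k / k%:R <= U + 4 * q%:R / (n%:R - 1)) ->
  limn (series lterm) <= V.
Proof.
move=> UV hU; pose e := (V - U) / 2; have e0 : 0 < e by rewrite /e; lra.
have q0 : 0 <= q%:R :> R by rewrite ler0n.
have qe0 : 0 <= 4 * q%:R / e by apply: divr_ge0; [exact: mulr_ge0 | exact: ltW].
have [M hM] : exists M : nat, 4 * q%:R / e < M%:R :> R.
  exists (Num.truncn (4 * q%:R / e)).+1.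
  by have /andP[] := truncn_itv qe0.
apply: limr_le; first exact: cvg_lterm.
exists (M + q.*2)%N => // n /= hn; rewrite series_lterm.
apply: le_trans (hU _ _) _; first by rewrite ltnS (leq_trans _ hn) // leq_addl.
rewrite -(natr1 n) addrK.
have n0 : 0 < n%:R :> R.
  apply: lt_le_trans (_ : M%:R <= _); last by rewrite ler_nat (leq_trans _ hn) // leq_addr.
  exact: le_lt_trans hM.
have : 4 * q%:R / n%:R <= e.
  rewrite ler_pdivrMr // [e * _]mulrC -ler_pdivrMr //; apply: le_trans (ltW hM) _.
  by rewrite ler_nat (leq_trans _ hn) // leq_addr.
rewrite /e; lra.
Qed.
End Limit.

Lemma cvg_real_complex (R : realType) (u : nat -> R) (l : R) :
  (u @ \oo --> l)%classic -> ((fun n => (u n)%:C%C : R[i]^o) @ \oo --> (l%:C%C : R[i]^o))%classic.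
Proof.
move=> ul; apply/cvgrPdist_lt => e e0.
have [re ee] : exists re, e = re%:C%C.
  by apply/complex_realP; rewrite gtr0_real.
rewrite ee ltcR in e0.
move/cvgrPdist_lt: ul => /(_ _ e0) [M _ hM].
exists M => // n /hM /= h; rewrite ee -rmorphB normc_def /= expr0n addr0 sqrtr_sqr.
by rewrite ltcR.
Qed.

(** Here v = sqrt q, lr and lv are the logarithms of r and v, h and h2 the harmonic numbers of r and
    2r - 2, and l = ln (2r - 2). Then W <= lr + 0.643 + 2 * 0.694 - 1.5 + 0.002 = lr + 0.533; the
    hats add at most 1.001, and the remaining errors 0.002. The total excess over lv is 1.536, which
    is why the saving has to reach 1.54. *)
Lemma log_budget (R : realType) (lr lv l2 v r D W S h h2 l : R) :
  1000 <= v -> v < r -> r <= v + 1 -> 1 / 4 <= lv -> lr <= lv + 1 / 1000 ->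
  l2 <= 694 / 1000 -> 154 / 100 <= D ->
  W = 2 * h2 - h - 3 / 2 + 3 / (2 * r) -> S = W - D ->
  h2 - l <= h - lr -> h2 - l <= 643 / 1000 -> l <= l2 + lr ->
  S + v * (((r - 1)^-1 + r^-1) / 2) + ((2 * r - 1) * (2 * r - 2))^-1 < lv.
Proof.
move=> hv vr rv lv0 lrv l2l hD hW hS h1 h3 h4.
have rr : 1000 <= r by lra.
have p1 : 0 < r - 1 by lra.
have p0 : 0 < r by lra.
have p2 : 0 < 2 * r by lra.
have e1 : (r - 1)^-1 <= 1 / 500 by rewrite -[leLHS]mul1r ler_pdivrMr //; lra.
have e2 : v * (((r - 1)^-1 + r^-1) / 2) <= 1 + 1 / 1000.
  apply: (@le_trans _ _ (r * (((r - 1)^-1 + r^-1) / 2))).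
    apply: ler_wpM2r; last exact: ltW.
    by apply: divr_ge0 => //; apply: addr_ge0; rewrite invr_ge0 ltW.
  have -> : r * (((r - 1)^-1 + r^-1) / 2) = 1 + (r - 1)^-1 / 2.
    by field; rewrite !lt0r_neq0.
  have : 0 <= (r - 1)^-1 by rewrite invr_ge0 ltW.
  lra.
have e3 : ((2 * r - 1) * (2 * r - 2))^-1 <= 1 / 1000.
  have p3 : 0 < (2 * r - 1) * (2 * r - 2) by nra.
  rewrite -[leLHS]mul1r ler_pdivrMr //; nra.
have e4 : 3 / (2 * r) <= 1 / 500 by rewrite ler_pdivrMr //; lra.
rewrite hS hW; lra.
Qed.

Lemma limn_lterm_le_half_ln (R : realType) (q : nat) (x : nat -> R) :
  odd_quad_char q x -> 2 * 10 ^+ 23 <= q%:R :> R ->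
  limn (series (lterm x)) <= ln q%:R / 2.
Proof.
move=> hx hq.
have [v [v0 vE vv v11]] : exists v : R,
    [/\ 0 < v, v = Num.sqrt q%:R, v ^+ 2 = q%:R & 10 ^+ 11 <= v].
  have q10 : 10 ^+ 23 <= q%:R :> R.
    by apply: le_trans hq; rewrite ler_peMl ?exprn_ge0 //; lra.
  have q0 : 0 < q%:R :> R by apply: lt_le_trans q10; rewrite exprn_gt0.
  have vv : Num.sqrt (q%:R : R) ^+ 2 = q%:R by rewrite sqr_sqrtr // ltW.
  exists (Num.sqrt q%:R); split; rewrite ?sqrtr_gt0 //.
  rewrite -(@ler_pXn2r _ 2) ?nnegrE ?exprn_ge0 ?sqrtr_ge0 // vv -exprM.
  by apply: le_trans q10; rewrite ler_weXn2l //; lra.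
have lnq : ln q%:R = 2 * ln v by rewrite -vv lnXn // mulr_natl.
have lnq77 : 77 * ln 2 <= ln (q%:R : R).
  have -> : 77 * ln 2 = ln (2 ^+ 77) :> R by rewrite lnXn // mulr_natl.
  have q0 : 0 < q%:R :> R by rewrite -vv exprn_gt0.
  rewrite ler_ln ?posrE ?exprn_gt0 //; apply: le_trans hq.
  by rewrite -!natrX -natrM ler_nat pow2_77.
have [r r2 rv] : exists2 r : nat, v < r%:R & r%:R <= v + 1.
  have /andP[r1 r2] := truncn_itv (ltW v0).
  by exists (Num.truncn v).+1 => //; rewrite -natr1 lerD2r.
have r11 : 10 ^+ 11 <= r%:R :> R by apply: le_trans v11 (ltW r2).
have v1000 : 1000 <= v by apply: le_trans v11; rewrite !exprS expr0; clear; lra.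
clear hq v11.
have rpos : 0 < r%:R :> R by exact: lt_trans r2.
have lnvr : ln v <= ln r%:R by rewrite ler_ln ?posrE // ltW.
have l2g := ln2_ge R; have l2l := ln2_le R.
have hl : 266 / 10 <= ln r%:R :> R by clear -lnvr l2g lnq77 lnq; lra.
have D := saving_large hx r11 hl.
rewrite -vE in D; have {}D := D (ltW r2).
have r100 : (100 <= r)%N by rewrite -(ler_nat R); clear -v1000 r2; lra.
clear r11.
have lnrv : ln r%:R <= ln v + 1 / 1000.
  have h : ln (r%:R / v) <= r%:R / v - 1 by apply: ln_le_sub1; rewrite divr_gt0.
  rewrite ln_div ?posrE // in h.
  have h' : r%:R / v <= 1 + 1 / 1000 by rewrite ler_pdivrMr //; clear -rv v1000; lra.
  by clear -h h'; lra.
have rge2 : (2 <= r)%N by apply: leq_trans r100.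
have hx2 : \sum_(1 <= n < r.*2.-1) x n * wt R r n =
    \sum_(1 <= n < r.*2.-1) wt R r n - saving x r.
  by rewrite /saving -sumrB; apply: eq_bigr => n _; rewrite mulrBr mulr1 opprB addrC subrK mulrC.
have h1 : harm R r.*2.-2 - ln r.*2.-2%:R <= harm R r - ln r%:R.
  by apply: harm_ln_dec; clear -r100; lia.
have h2 : harm R r.*2.-2 - ln r.*2.-2%:R <= 643 / 1000.
  by apply: harm_le; clear -r100; lia.
have h3 : ln r.*2.-2%:R <= ln 2 + ln r%:R :> R.
  rewrite -(@lnnM R 2 r) //; last by clear -r100; lia.
  by apply: lnn_le; clear -r100; lia.
have lv0 : 1 / 4 <= ln v by clear -lnq77 lnq l2g; lra.
have := log_budget v1000 r2 rv lv0 lnrv l2l D (sum_wt R rge2) hx2 h1 h2 h3.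
have -> : ln v = ln q%:R / 2 by rewrite lnq; field.
rewrite {1}vE => hU; apply: (limn_lterm_le hx hU) => n hn.
apply: partial_L_le => //; apply: leq_ltn_trans hn; rewrite leq_double.
rewrite -(ler_nat R) -vv expr2; apply: le_trans rv _; clear -v1000; nra.
Qed.

Theorem theorem1 (R : realType) (q : nat) (chi : int -> R[i])
    (hq : 2 * 10 ^+ 23 <= q%:R :> R)
    (hchar : dirichlet_character q chi)
    (hquad : quadratic q chi)
    (hodd : odd_character chi)
    (hprim : primitive q chi) :
  dirichlet_L chi 1 <= (ln (q%:R : R) / 2)%:C.
Proof.
have q1 : (1 < q)%N.
  rewrite -(ltr_nat R); apply: lt_le_trans hq.
  have : 1 <= 10 ^+ 23 :> R by rewrite exprn_ege1 //; lra.
  lra.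
have [hreal _] := hquad.
pose x := rchar chi.
have hx : odd_quad_char q x := rchar_oqc q1 hchar hreal hodd hprim.
have E k : chi k.+1%:Z * natpowN k.+1 1 = (lterm x k)%:C.
  rewrite rcharE // /natpowN /= mul1r mul0r cos0 sin0 expRN lnK ?posrE ?ltr0n //.
  by rewrite oppr0 [1 +i* 0](_ : _ = 1) // mulr1 -rmorphM.
have -> : dirichlet_L chi 1 = (limn (series (lterm x)))%:C.
  have eS : series (fun k : nat => (chi k.+1%:Z * natpowN k.+1 1) : R[i]^o) =
      (fun n => (series (lterm x) n)%:C : R[i]^o).
    by apply/funext => n; rewrite /series /= rmorph_sum; apply: eq_bigr => k _; exact: E.
  rewrite /dirichlet_L eS; apply: (@cvg_lim (R[i]^o)); first exact: norm_hausdorff.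
  by apply: cvg_real_complex; exact: (cvg_lterm hx).
by rewrite lecR; apply: limn_lterm_le_half_ln.
Qed.
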